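(* Let $z\in\mathbb{C}\setminus\{0\}$ and $0\le x<1$ be fixed. The Lerch-type Dirichlet series $\varphi(z,s,x)=\sum_{n=1}^{\infty}z^n(a_n+x)^{-s}$, which as a function of $s$ is holomorphic in the half-plane $\Re(s)>\frac{\log|z|}{\log\alpha_1}$, has an analytic continuation to a meromorphic function of the whole $s$-plane whose poles are all simple and lie at the points $$-j+s^{(z)}_{n,k_1,\dots,k_{r-1}},\qquad j,n,k_i\in\mathbb{Z},\quad j\ge 0,\quad k_1\ge\dots\ge k_{r-1}\ge 0 .$$
   Context: Setting: $\{a_n\}_{n\ge 1}$ is a linear recurrence sequence over $\mathbb{Z}$, i.e. a sequence of integers for which there is a monic $Q\in\mathbb{Z}[X]$ with $Q(\nabla)a_n=0$ for all $n$, where $\nabla a_n=a_{n+1}$. Its minimal polynomial $P\in\mathbb{Z}[X]$ (the monic polynomial of least degree with $P(\nabla)$ annihilating $\{a_n\}$) is assumed irreducible over $\mathbb{Q}$, of degree $r$, with (simple) roots $\alpha_1,\dots,\alpha_r\in\mathbb{C}$, and $\alpha_1$ is a dominant root: $\alpha_1$ is real, $\alpha_1>1$ and $\alpha_1>|\alpha_i|$ for $i=2,\dots,r$. The sequence $\{a_n\}$ is assumed to be a strictly increasing sequence of positive integers. Powers $(a_n+x)^{-s}$ are defined through the real logarithm. Notation: $\xi=\frac{1}{2\pi}\arg(z)$, so $z=|z|e^{2\pi i\xi}$. For integers $n$ and $k_1\ge\dots\ge k_{r-1}\ge 0$, $$s_{n,k_1,\dots,k_{r-1}}=\frac{\log\left|\alpha_1^{-k_1}\alpha_2^{k_1-k_2}\cdots\alpha_{r-1}^{k_{r-2}-k_{r-1}}\alpha_r^{k_{r-1}}\right|}{\log\alpha_1}+i\,\frac{\arg\left(\alpha_2^{k_1-k_2}\cdots\alpha_{r-1}^{k_{r-2}-k_{r-1}}\alpha_r^{k_{r-1}}\right)+2\pi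 n}{\log\alpha_1}$$ (with the convention $k_r=0$ the product is $\alpha_1^{-k_1}\prod_{i=2}^r\alpha_i^{k_{i-1}-k_i}$), and $$s^{(z)}_{n,k_1,\dots,k_{r-1}}=\frac{\log|z|}{\log\alpha_1}+i\,\frac{2\pi\xi}{\log\alpha_1}+s_{n,k_1,\dots,k_{r-1}}.$$ *)

(* Defs.v *)
From HB Require Import structures.
From mathcomp Require Import all_boot all_order all_algebra.
From mathcomp Require Import all_classical all_reals all_analysis.
From mathcomp Require Import complex.

Set Implicit Arguments.
Unset Strict Implicit.
Unset Printing Implicit Defensive.

Import Order.TTheory GRing.Theory Num.Theory.
Import numFieldNormedType.Exports.

Local Open Scope ring_scope.
Local Open Scope complex_scope.
Local Open Scope classical_set_scope.

(* Sequences are indexed from 1: the value [a 0] never matters. *)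

(* [Q(nabla) a_n = 0] for all [n >= 1], where [nabla] is the shift. *)
Definition annihilates (Q : {poly int}) (a : nat -> int) : Prop :=
  forall n : nat, (1 <= n)%N -> \sum_(i < size Q) Q`_i * a (n + i)%N = 0.

(* In particular, [a] is then a linear recurrence sequence over the integers. *)
Definition is_minimal_polynomial (P : {poly int}) (a : nat -> int) : Prop :=
  [/\ P \is monic, annihilates P a &
      forall Q : {poly int}, Q \is monic -> annihilates Q a ->
        (size P <= size Q)%N].

Section Complex.
Variable R : realType.
Implicit Types (z s p : R[i]) (F : R[i] -> R[i]).

(* Principal argument, in ]-pi, pi], of z != 0; the value at 0 is junk. *)
Definition carg z : R :=
  if 0 <= complex.Im z then acos (complex.Re z / ComplexField.Normc.normc z)
  else - acos (complex.Re z / ComplexField.Normc.normc z).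

Definition cexp z : R[i] :=
  (expR (complex.Re z))%:C * (cos (complex.Im z) +i* sin (complex.Im z)).

(* [t ^ s] for a real [t > 0], through the real logarithm. *)
Definition cpow (t : R) s : R[i] := cexp (s * (ln t)%:C).

(* The topology and the scalar field are those of [R[i]^o], i.e. [R[i]] seen
   as a normed space over itself: [derivable] is complex differentiability. *)
Definition holomorphic_at F p : Prop :=
  \forall s \near (p : R[i]^o), derivable (F : R[i]^o -> R[i]^o) s 1.

Definition is_pole (m : nat) F p : Prop :=
  (0 < m)%N /\
  exists g : R[i] -> R[i],
    [/\ holomorphic_at g p, g p != 0 &
        \forall s \near (p : R[i]^o)^', F s = g s / (s - p) ^+ m].

(* The value of a meromorphic function at one of its poles is junk. *)
Definition meromorphic F : Prop :=
  forall p, holomorphic_at F p \/ exists m : nat, is_pole m F p.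

End Complex.

Section Lerch.
Variable R : realType.

Definition lerch_partial_sum (a : nat -> int) (z : R[i]) (x : R) (s : R[i])
    (N : nat) : R[i]^o :=
  \sum_(1 <= n < N.+1) z ^+ n * cpow ((a n)%:~R + x) (- s).

(* [lim] is the genuine sum only where the series converges. *)
Definition lerch_phi (a : nat -> int) (z : R[i]) (x : R) (s : R[i]) : R[i] :=
  lim (lerch_partial_sum a z x s @ \oo).

(* [k_1 >= ... >= k_(r-1) >= 0], with the convention [k_r = 0]. *)
Definition admissible (r : nat) (k : nat -> nat) : Prop :=
  (forall i : nat, (1 <= i < r)%N -> (k i.+1 <= k i)%N) /\ k r = 0%N.

(* [alpha_2^(k_1-k_2) ... alpha_r^(k_(r-1)-k_r)]; the truncated subtraction is
   exact for admissible [k]. *)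
Definition tail_prod (r : nat) (alpha : nat -> R[i]) (k : nat -> nat) : R[i] :=
  \prod_(2 <= i < r.+1) alpha i ^+ (k i.-1 - k i)%N.

Definition s_point (r : nat) (alpha : nat -> R[i]) (n : int) (k : nat -> nat)
    : R[i] :=
  (ln (ComplexField.Normc.normc (alpha 1%N ^- k 1%N * tail_prod r alpha k))
     / ln (complex.Re (alpha 1%N)))
  +i* ((carg (tail_prod r alpha k) + 2 * pi * n%:~R)
     / ln (complex.Re (alpha 1%N))).

Definition xi (z : R[i]) : R := carg z / (2 * pi).

Definition sz_point (r : nat) (alpha : nat -> R[i]) (z : R[i]) (n : int)
    (k : nat -> nat) : R[i] :=
  ((ln (ComplexField.Normc.normc z) / ln (complex.Re (alpha 1%N)))
   +i* (2 * pi * xi z / ln (complex.Re (alpha 1%N))))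
  + s_point r alpha n k.

End Lerch.

(* Main.v *)
Require Import Defs.
From HB Require Import structures.
From mathcomp Require Import all_boot all_order all_algebra.
From mathcomp Require Import all_classical all_reals all_analysis.
From mathcomp Require Import complex separable qpoly.
From mathcomp Require Import ring lra zify.

Set Implicit Arguments.
Unset Strict Implicit.
Unset Printing Implicit Defensive.

Import Order.TTheory GRing.Theory Num.Theory.
Import numFieldNormedType.Exports.

Local Open Scope ring_scope.
Local Open Scope complex_scope.
Local Open Scope classical_set_scope.

(** Write A = alpha_1.  Since P is separable, the linear form X^n |-> a_(n+1)
    on polynomials, which kills the multiples of P, evaluates through Lagrange
    interpolation at the roots to a_n = sum_i c_i alpha_i^n ([binet]).  Here
    c_1 <> 0: otherwise a nonzero polynomial of degree < r would kill the
    complex Hankel matrix of the sequence, hence a rational one would too, and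
    by Bezout with the irreducible P so would 1, although a_1 > 0.  As
    a_n / A^n tends to c_1, in fact c_1 > 0.  Hence, for n large,

      a_n + x = c_1 A^n (1 + eps_n),   eps_n = sum_i d_i beta_i^n,

    where the beta_i are 1 / A (which carries x) and alpha_2 / A, ...,
    alpha_r / A, all of modulus < 1.  Let N satisfy
    sum_i |d_i| |beta_i|^N < 1.  The binomial series ([binomial_series]), the
    expansion of eps_n^m over the words t of length m in the indices i, and the
    geometric series over n >= N then turn the Dirichlet series into

      sum_(n < N) z^n (a_n + x)^(-s)  +  c_1^(-s) W(s)^N
        sum_m binom(-s, m) sum_(|t| = m) d_t beta_t^N / (1 - W(s) beta_t),

    with W(s) = z A^(-s) and d_t, beta_t the products of the letters
    ([dirichlet_cvg]).  The right-hand side makes sense for every s.  Near a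
    point p every word with |W beta_t| > 1/2 has length below some M, so
    only finitely many denominators can vanish at p; those that do are all equal
    to 1 - exp (- (s - p) log A).  Near p the continuation is therefore
    holomorphic up to q(s) k(s) / (s - p), where q is a polynomial and k is
    holomorphic with k(p) <> 0 ([local_structure]).  If q(p) = 0 the
    singularity is removable, else the pole is simple and W(p) beta_t = 1 for
    some word t; taking logarithms, and reading the exponents k_i off the
    numbers of letters >= i of t, gives the announced position
    ([pole_location]).

    That the infinite sums are holomorphic is obtained without Cauchy's theory,
    from functions with bounded first and second divided differences
    ([tame]).  The sum of the bounds on values and differences is
    submultiplicative and survives pointwise limits up to a factor 3, and a
    bounded second divided difference forces complex differentiability
    ([tame_derivable]).  Everything else reduces to polynomials in s, to exp,
    and to (exp u - 1) / u, which is a limit of Riemann sums of exponentials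
    ([expm1_quotient_tame]). *)

Local Notation nrm := ComplexField.Normc.normc.

(** * Norm and convergence of complex numbers *)

Section Norm.
Variable R : realType.
Implicit Types (z w : R[i]) (x : R).

Lemma nrmE z : `|z| = (nrm z)%:C. Proof. by []. Qed.

Lemma lecE x y : ((x%:C : R[i]) <= y%:C) = (x <= y).
Proof. by rewrite lecR. Qed.

Lemma nrm_ge0 z : 0 <= nrm z.
Proof. by case: z => a b; exact: sqrtr_ge0. Qed.

Lemma nrm0 : nrm (0 : R[i]) = 0. Proof. exact: ComplexField.Normc.normc0. Qed.
Lemma nrm1 : nrm (1 : R[i]) = 1. Proof. exact: ComplexField.Normc.normc1. Qed.

Lemma nrm_eq0 z : (nrm z == 0) = (z == 0).
Proof.
apply/eqP/eqP => [|->]; first exact: ComplexField.Normc.eq0_normc.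
exact: nrm0.
Qed.

Lemma nrm_gt0 z : (0 < nrm z) = (z != 0).
Proof. by rewrite lt_neqAle nrm_ge0 andbT eq_sym nrm_eq0. Qed.

Lemma nrmM z w : nrm (z * w) = nrm z * nrm w.
Proof. exact: ComplexField.Normc.normcM. Qed.

Lemma nrmV z : nrm z^-1 = (nrm z)^-1.
Proof. exact: ComplexField.Normc.normcV. Qed.

Lemma nrmD z w : nrm (z + w) <= nrm z + nrm w.
Proof. by rewrite -lecE rmorphD -!nrmE; exact: ler_normD. Qed.

Lemma nrmN z : nrm (- z) = nrm z.
Proof. by case: z => a b /=; rewrite !sqrrN. Qed.

Lemma nrmB z w : nrm (z - w) <= nrm z + nrm w.
Proof. by rewrite -(nrmN w); exact: nrmD. Qed.

Lemma nrm_distC z w : nrm (z - w) = nrm (w - z).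
Proof. by rewrite -nrmN opprB. Qed.

Lemma nrmX z n : nrm (z ^+ n) = nrm z ^+ n.
Proof. by elim: n => [|n IH]; rewrite ?expr0 ?nrm1 // !exprS nrmM IH. Qed.

Lemma nrm_sum (I : Type) (s : seq I) (P : pred I) (F : I -> R[i]) :
  nrm (\sum_(i <- s | P i) F i) <= \sum_(i <- s | P i) nrm (F i).
Proof.
elim/big_rec2: _ => [|i x y _ h]; first by rewrite nrm0.
by apply: le_trans (nrmD _ _) _; rewrite lerD2l.
Qed.

Lemma nrm_prod (I : Type) (s : seq I) (P : pred I) (F : I -> R[i]) :
  nrm (\prod_(i <- s | P i) F i) = \prod_(i <- s | P i) nrm (F i).
Proof. by elim/big_rec2: _ => [|i x y _ h]; rewrite ?nrm1 // nrmM h. Qed.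

Lemma nrm_real x : nrm x%:C = `|x|.
Proof. by rewrite /= expr0n addr0 sqrtr_sqr. Qed.

Lemma nrm_nat n : nrm (n%:R : R[i]) = n%:R.
Proof. by rewrite -(rmorph_nat (real_complex R)) nrm_real ger0_norm. Qed.

Lemma Re_le_nrm z : `|complex.Re z| <= nrm z.
Proof.
case: z => a b /=; rewrite -sqrtr_sqr ler_sqrt ?lerDl ?sqr_ge0 //.
by rewrite addr_ge0 // sqr_ge0.
Qed.

Lemma Im_le_nrm z : `|complex.Im z| <= nrm z.
Proof.
case: z => a b /=; rewrite -sqrtr_sqr ler_sqrt ?lerDr ?sqr_ge0 //.
by rewrite addr_ge0 // sqr_ge0.
Qed.

Lemma nrm_i : nrm ('i : R[i]) = 1.
Proof. by rewrite /= expr0n expr1n add0r sqrtr1. Qed.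

Lemma nrm_le_ReIm z : nrm z <= `|complex.Re z| + `|complex.Im z|.
Proof.
rewrite {1}[z]complexE; apply: le_trans (nrmD _ _) _.
by rewrite nrmM nrm_i mul1r !nrm_real.
Qed.

Lemma cReD z w : complex.Re (z + w) = complex.Re z + complex.Re w.
Proof. by case: z w => [a b] [c d]. Qed.
Lemma cImD z w : complex.Im (z + w) = complex.Im z + complex.Im w.
Proof. by case: z w => [a b] [c d]. Qed.
Lemma cReM z w : complex.Re (z * w) =
  complex.Re z * complex.Re w - complex.Im z * complex.Im w.
Proof. by case: z w => [a b] [c d]. Qed.
Lemma cImM z w : complex.Im (z * w) =
  complex.Re z * complex.Im w + complex.Im z * complex.Re w.
Proof. by case: z w => [a b] [c d]. Qed.
Lemma cReN z : complex.Re (- z) = - complex.Re z. Proof. by case: z. Qed.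
Lemma cImN z : complex.Im (- z) = - complex.Im z. Proof. by case: z. Qed.

Lemma complex_ext z w : complex.Re z = complex.Re w ->
  complex.Im z = complex.Im w -> z = w.
Proof. by case: z w => [a b] [c d] /= -> ->. Qed.

End Norm.

Section Topology.
Variable R : realType.
Local Notation C := (R[i]^o).

Lemma near_nrm (p : C) (P : set C) :
  (\forall s \near p, P s) <->
  exists2 e : R, 0 < e & forall s, nrm (s - p) < e -> P s.
Proof.
split => [/nbhs_ballP [e /= e0 h]|[e e0 h]].
  have er : e = (complex.Re e)%:C by rewrite RRe_real // ger0_real // ltW.
  exists (complex.Re e); first by rewrite -ltcR -er.
  move=> s hs; apply: h; rewrite -ball_normE /= distrC nrmE er ltcR //.
apply/nbhs_ballP; exists e%:C; first by rewrite /= ltcR.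
by move=> s; rewrite -ball_normE /= distrC nrmE ltcR; exact: h.
Qed.

Lemma dnear_nrm (p : C) (P : set C) :
  (\forall s \near p^', P s) <->
  exists2 e : R, 0 < e & forall s, s != p -> nrm (s - p) < e -> P s.
Proof.
rewrite near_withinE; split => [/near_nrm|] [e e0 h].
  by exists e => // s sp hs; exact: h.
by apply/near_nrm; exists e => // s hs sp; exact: h.
Qed.

Lemma cvg_nrm (T : Type) (F : set_system T) (FF : Filter F) (u : T -> C) (l : C) :
  u @ F --> l <-> forall e : R, 0 < e -> \forall t \near F, nrm (u t - l) < e.
Proof.
split => [h e e0|h].
  have hn : \forall s \near l, nrm (s - l) < e by apply/near_nrm; exists e.
  exact: h hn.
move=> /= A /near_nrm [e e0 hA].
have := h e e0; rewrite !near_simpl /=; apply: filterS => t; exact: hA.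
Qed.

Lemma cvgn_nrm (u : nat -> C) (l : C) :
  u @ \oo --> l <-> forall e : R, 0 < e ->
  exists N, forall n, (N <= n)%N -> nrm (u n - l) < e.
Proof.
rewrite cvg_nrm; split => h e e0; have := h e e0.
  by case=> N _ hN; exists N.
by case=> N hN; exists N.
Qed.

Lemma cvgn_nrm_le (u : nat -> C) (l : C) (M : R) :
  u @ \oo --> l -> (forall n, nrm (u n) <= M) -> nrm l <= M.
Proof.
move=> /cvgn_nrm h hM; apply/ler_addgt0Pr => e /h [N /(_ _ (leqnn N)) hN].
rewrite -[l](subrK (u N)) addrC.
apply: le_trans (nrmD _ _) _; rewrite lerD // nrm_distC; exact: ltW.
Qed.

Lemma dominated_cvg (u : nat -> C) (l : C) (v : nat -> R) N :
  (forall n, (N <= n)%N -> nrm (u n - l) <= v n) -> v @ \oo --> 0 ->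
  u @ \oo --> l.
Proof.
move=> h /cvgrPdist_lt hv; apply/cvgn_nrm => e e0.
have [M _ hM] := hv e e0; exists (maxn N M) => n.
rewrite geq_max => /andP[hN hMn]; apply: le_lt_trans (h _ hN) _.
have := hM n hMn; rewrite sub0r normrN; apply: le_lt_trans; exact: ler_norm.
Qed.

(** Completeness of C, obtained from the real and imaginary parts. *)
Lemma abs_summable_cvg (u : nat -> C) (B : R) :
  (forall n, \sum_(k < n) nrm (u k) <= B) ->
  exists l : C, (fun n => \sum_(k < n) u k) @ \oo --> l.
Proof.
move=> hB.
have key (f : nat -> R) : (forall k, `|f k| <= nrm (u k)) -> cvgn (series f).
  move=> hf; apply: normed_cvg; apply: nondecreasing_is_cvgn.
    by apply/nondecreasing_seqP => n; rewrite /= /series /= big_nat_recr //= lerDl.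
  exists B => _ [n _ <-]; apply: le_trans (hB n).
  by rewrite /= /series /= big_mkord; apply: ler_sum => k _.
have hr : cvgn (series (fun k => complex.Re (u k))).
  by apply: key => k; exact: Re_le_nrm.
have hi : cvgn (series (fun k => complex.Im (u k))).
  by apply: key => k; exact: Im_le_nrm.
move/cvgrPdist_lt: hr => hr; move/cvgrPdist_lt: hi => hi.
exists (limn (series (fun k => complex.Re (u k))) +i*
  limn (series (fun k => complex.Im (u k)))).
apply/cvgn_nrm => e e0; have e2 : 0 < e / 2 by rewrite divr_gt0.
have [N1 _ h1] := hr _ e2; have [N2 _ h2] := hi _ e2.
exists (maxn N1 N2) => n; rewrite geq_max => /andP[n1 n2].
apply: le_lt_trans (nrm_le_ReIm _) _; rewrite cReD cImD cReN cImN /=.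
have sRe : complex.Re (\sum_(k < n) u k) = series (fun k => complex.Re (u k)) n.
  by rewrite /series /= big_mkord; elim/big_rec2: _ => [|i x y _ <-] //; rewrite cReD.
have sIm : complex.Im (\sum_(k < n) u k) = series (fun k => complex.Im (u k)) n.
  by rewrite /series /= big_mkord; elim/big_rec2: _ => [|i x y _ <-] //; rewrite cImD.
rewrite sRe sIm [e]splitr ltrD // distrC; [exact: h1|exact: h2].
Qed.

End Topology.

(** * Functions with bounded divided differences *)

Section Tame.
Variable R : realType.
Implicit Types (D : set R[i]) (M : R) (f g : R[i] -> R[i]).

(** A finite norm m0 + m1 + m2, at most M, built from bounds m0, m1, m2 on the
    values, the first and the second divided differences over D.  The second
    divided difference is cleared of its denominators, so that coincident points
    need no separate treatment. *)
Definition tame D M f := exists m0 m1 m2 : R,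
  [/\ [/\ 0 <= m0, 0 <= m1, 0 <= m2 & m0 + m1 + m2 <= M],
      forall a, D a -> nrm (f a) <= m0,
      forall a b, D a -> D b -> nrm (f a - f b) <= m1 * nrm (a - b) &
      forall a b c, D a -> D b -> D c ->
        nrm ((f a - f b) * (a - c) - (f a - f c) * (a - b)) <=
        m2 * (nrm (a - b) * nrm (b - c) * nrm (a - c))].

Lemma tame_ge0 D M f : tame D M f -> 0 <= M.
Proof.
case=> m0 [m1 [m2 [[h0 h1 h2 h] _ _ _]]]; apply: le_trans h.
by rewrite !addr_ge0.
Qed.

Lemma tame_nrm D M f a : tame D M f -> D a -> nrm (f a) <= M.
Proof.
case=> m0 [m1 [m2 [[h0 h1 h2 h] hf _ _]]] Da.
apply: le_trans (hf a Da) _; apply: le_trans h; by lra.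
Qed.

Lemma tame_le D M M' f : M <= M' -> tame D M f -> tame D M' f.
Proof.
move=> MM' [m0 [m1 [m2 [[h0 h1 h2 h] k0 k1 k2]]]].
exists m0, m1, m2; split => //; split => //; exact: le_trans h MM'.
Qed.

Lemma tame_ext D M f g : (forall s, D s -> f s = g s) -> tame D M f -> tame D M g.
Proof.
move=> fg [m0 [m1 [m2 [h k0 k1 k2]]]]; exists m0, m1, m2; split => //.
- by move=> a Da; rewrite -fg //; exact: k0.
- by move=> a b Da Db; rewrite -!fg //; exact: k1.
- by move=> a b c Da Db Dc; rewrite -!fg //; exact: k2.
Qed.

Lemma tame_cst D (c : R[i]) : tame D (nrm c) (fun=> c).
Proof.
exists (nrm c), 0, 0; split => //.
- by split => //; rewrite ?nrm_ge0 // !addr0.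
- by move=> a b _ _; rewrite subrr nrm0 mul0r.
- by move=> a b d _ _ _; rewrite !subrr !mul0r subrr nrm0.
Qed.

Lemma tame_id D (r : R) : (forall s, D s -> nrm s <= r) -> 0 <= r ->
  tame D (r + 1) id.
Proof.
move=> hD r0; exists r, 1, 0; split => //.
- by split => //; rewrite ?addr0.
- by move=> a b _ _; rewrite mul1r.
- move=> a b d _ _ _; rewrite [X in nrm X](_ : _ = 0) ?nrm0 ?mul0r //.
  by rewrite /=; ring.
Qed.

Lemma tameD D M M' f g : tame D M f -> tame D M' g ->
  tame D (M + M') (fun s => f s + g s).
Proof.
move=> [m0 [m1 [m2 [[h0 h1 h2 h] k0 k1 k2]]]].
move=> [n0 [n1 [n2 [[i0 i1 i2 i] l0 l1 l2]]]].
exists (m0 + n0), (m1 + n1), (m2 + n2); split.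
- by split; [rewrite addr_ge0..|lra].
- by move=> a Da; apply: le_trans (nrmD _ _) _; rewrite lerD ?k0 ?l0.
- move=> a b Da Db; rewrite mulrDl opprD addrACA.
  by apply: le_trans (nrmD _ _) _; rewrite lerD ?k1 ?l1.
- move=> a b c Da Db Dc; rewrite [leRHS]mulrDl.
  rewrite [X in nrm X](_ : _ = ((f a - f b) * (a - c) - (f a - f c) * (a - b)) +
    ((g a - g b) * (a - c) - (g a - g c) * (a - b))); last by ring.
  by apply: le_trans (nrmD _ _) _; rewrite lerD ?k2 ?l2.
Qed.

(** Leibniz' rule for divided differences,
    (f g)[a,b,c] = f[a] g[a,b,c] + f[a,b] g[b,c] + f[a,b,c] g[c], makes the norm
    submultiplicative. *)
Lemma tameM D M M' f g : tame D M f -> tame D M' g ->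
  tame D (M * M') (fun s => f s * g s).
Proof.
move=> [m0 [m1 [m2 [[h0 h1 h2 h] k0 k1 k2]]]].
move=> [n0 [n1 [n2 [[i0 i1 i2 i] l0 l1 l2]]]].
exists (m0 * n0), (m0 * n1 + m1 * n0), (m0 * n2 + m1 * n1 + m2 * n0); split.
- split; rewrite ?addr_ge0 ?mulr_ge0 //.
  apply: (@le_trans _ _ ((m0 + m1 + m2) * (n0 + n1 + n2))).
    rewrite -subr_ge0 [X in 0 <= X](_ : _ = m1 * n2 + m2 * n1 + m2 * n2).
      by rewrite ?addr_ge0 ?mulr_ge0.
    by ring.
  by rewrite ler_pM // !addr_ge0.
- by move=> a Da; rewrite nrmM ler_pM ?nrm_ge0 ?k0 ?l0.
- move=> a b Da Db.
  rewrite [X in nrm X](_ : _ = f a * (g a - g b) + (f a - f b) * g b); last by ring.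
  apply: le_trans (nrmD _ _) _; rewrite [leRHS]mulrDl !nrmM lerD //.
    by rewrite -mulrA ler_pM ?nrm_ge0 ?k0 ?l1.
  by rewrite mulrAC ler_pM ?nrm_ge0 ?k1 ?l0.
- move=> a b c Da Db Dc.
  rewrite [X in nrm X](_ : _ =
    f a * ((g a - g b) * (a - c) - (g a - g c) * (a - b)) +
    (f a - f b) * (g b - g c) * (a - c) +
    ((f a - f b) * (a - c) - (f a - f c) * (a - b)) * g c); last by ring.
  rewrite [leRHS]mulrDl [X in _ <= X + _]mulrDl; apply: le_trans (nrmD _ _) _; rewrite lerD //.
    apply: le_trans (nrmD _ _) _; rewrite !(nrmM _ (_ - _)) ?(nrmM (f a)) lerD //.
      by rewrite -[m0 * n2 * _]mulrA ler_pM ?nrm_ge0 ?k0 ?l2.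
    rewrite !mulrA ler_wpM2r ?nrm_ge0 //.
    rewrite [X in _ <= X](_ : _ = (m1 * nrm (a - b)) * (n1 * nrm (b - c))).
      by rewrite ler_pM ?nrm_ge0 ?k1 ?l1.
    by ring.
  by rewrite nrmM mulrAC ler_pM ?nrm_ge0 ?k2 ?l0.
Qed.

Lemma tameZ D M (k : R[i]) f : tame D M f -> tame D (nrm k * M) (fun s => k * f s).
Proof. by apply: tameM; exact: tame_cst. Qed.

Lemma tameX D M f n : tame D M f -> tame D (M ^+ n) (fun s => f s ^+ n).
Proof.
move=> hf; elim: n => [|n IH].
  by rewrite expr0 -(nrm1 R); exact: tame_cst.
rewrite exprS; apply: tame_ext (tameM hf IH) => s _; by rewrite exprS.
Qed.

Lemma tame_sum D (I : Type) (s : seq I) (P : pred I) (m : I -> R) (F : I -> R[i] -> R[i]) :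
  (forall i, P i -> tame D (m i) (F i)) ->
  tame D (\sum_(i <- s | P i) m i) (fun x => \sum_(i <- s | P i) F i x).
Proof.
move=> h; elim: s => [|i s IH].
  rewrite big_nil -(nrm0 R).
  by apply: tame_ext (tame_cst D 0) => x _; rewrite big_nil.
rewrite big_cons; case: ifPn => Pi; last first.
  by apply: tame_ext IH => x _; rewrite big_cons (negbTE Pi).
by apply: tame_ext (tameD (h i Pi) IH) => x _; rewrite big_cons Pi.
Qed.

Lemma tame_prod D (I : Type) (s : seq I) (P : pred I) (m : I -> R) (F : I -> R[i] -> R[i]) :
  (forall i, P i -> tame D (m i) (F i)) ->
  tame D (\prod_(i <- s | P i) m i) (fun x => \prod_(i <- s | P i) F i x).
Proof.
move=> h; elim: s => [|i s IH].
  rewrite big_nil -(nrm1 R).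
  by apply: tame_ext (tame_cst D 1) => x _; rewrite big_nil.
rewrite big_cons; case: ifPn => Pi; last first.
  by apply: tame_ext IH => x _; rewrite big_cons (negbTE Pi).
by apply: tame_ext (tameM (h i Pi) IH) => x _; rewrite big_cons Pi.
Qed.

(** A divided difference of order j scales by k^j; K dominates 1 and |k|. *)
Lemma tame_affine D D' M f (k c : R[i]) (K : R) : nrm k <= K -> 1 <= K ->
  (forall s, D s -> D' (k * s + c)) -> tame D' M f ->
  tame D (K ^+ 2 * M) (fun s => f (k * s + c)).
Proof.
move=> kK K1 DD [m0 [m1 [m2 [[h0 h1 h2 h] k0 k1 k2]]]].
have K0 : 0 <= K by lra.
have hk0 := nrm_ge0 k.
have e a b : k * a + c - (k * b + c) = k * (a - b) by ring.
have KK : 1 <= K ^+ 2 by rewrite expr_ge1.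
have KK1 : K <= K ^+ 2 by rewrite expr2 ler_peMr.
exists m0, (m1 * nrm k), (m2 * nrm k ^+ 2); split.
- split; rewrite ?mulr_ge0 ?exprn_ge0 //.
  apply: (@le_trans _ _ (K ^+ 2 * (m0 + m1 + m2))); last by rewrite ler_wpM2l ?exprn_ge0.
  rewrite 2!mulrDr !lerD //.
  + by rewrite ler_peMl.
  + by rewrite mulrC ler_wpM2r // (le_trans kK).
  + by rewrite mulrC ler_wpM2r // lerXn2r ?nnegrE.
- by move=> a Da; apply: k0; exact: DD.
- by move=> a b Da Db; apply: le_trans (k1 _ _ (DD _ Da) (DD _ Db)) _; rewrite e nrmM mulrA.
- move=> a b d Da Db Dd; have [k00|kn0] := eqVneq k 0.
    rewrite k00 !mul0r !subrr !mul0r subrr nrm0 !mulr_ge0 ?exprn_ge0 ?nrm_ge0 //.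
  have kp : 0 < nrm k by rewrite nrm_gt0.
  rewrite -(ler_pM2r kp) -[X in X <= _]nrmM.
  have -> : ((f (k * a + c) - f (k * b + c)) * (a - d) -
      (f (k * a + c) - f (k * d + c)) * (a - b)) * k =
    (f (k * a + c) - f (k * b + c)) * ((k * a + c) - (k * d + c)) -
    (f (k * a + c) - f (k * d + c)) * ((k * a + c) - (k * b + c)).
    by rewrite !e; ring.
  apply: le_trans (k2 _ _ _ (DD _ Da) (DD _ Db) (DD _ Dd)) _.
  by rewrite !e !nrmM le_eqVlt; apply/orP; left; apply/eqP; ring.
Qed.

(** Each bound is a closed condition on finitely many values, so pointwise
    convergence suffices. *)
Lemma tame_lim D M (f : nat -> R[i] -> R[i]) g :
  (forall n, tame D M (f n)) ->
  (forall s, D s -> (fun n => f n s : R[i]^o) @ \oo --> (g s : R[i]^o)) ->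
  tame D (3 * M) g.
Proof.
move=> hf hg; have M0 := tame_ge0 (hf 0%N).
(* The three constants of f n may vary with n, but M bounds each of them. *)
exists M, M, M; split => [|a Da|a b Da Db|a b c Da Db Dc].
- by split => //; lra.
- by apply: (cvgn_nrm_le (hg a Da)) => n; exact: tame_nrm (hf n) Da.
- have h : (fun n => (f n a - f n b : R[i]^o)) @ \oo --> (g a - g b : R[i]^o).
    by apply: cvgB; exact: hg.
  apply: (cvgn_nrm_le h) => n.
  have [m0 [m1 [m2 [[h0 h1 h2 hh] k0 k1 k2]]]] := hf n.
  apply: le_trans (k1 a b Da Db) _; rewrite ler_wpM2r ?nrm_ge0 //; lra.
- have h : (fun n => ((f n a - f n b) * (a - c) - (f n a - f n c) * (a - b) : R[i]^o)) @ \oo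
      --> ((g a - g b) * (a - c) - (g a - g c) * (a - b) : R[i]^o).
    apply: cvgB; apply: cvgMr_tmp; apply: cvgB; exact: hg.
  apply: (cvgn_nrm_le h) => n.
  have [m0 [m1 [m2 [[h0 h1 h2 hh] k0 k1 k2]]]] := hf n.
  apply: le_trans (k2 a b c Da Db Dc) _; rewrite ler_wpM2r ?mulr_ge0 ?nrm_ge0 //; lra.
Qed.

End Tame.

(** * Complex differentiability of tame functions *)

Section Deriv.
Variable R : realType.
Implicit Types (D : set R[i]) (M : R) (f g : R[i] -> R[i]).

Definition disc (p : R[i]) (r : R) : set R[i] := [set s | nrm (s - p) < r].

Lemma geo_half_sum (n : nat) : \sum_(k < n) (2^-1 : R) ^+ k.+1 <= 1.
Proof.
suff -> : \sum_(k < n) (2^-1 : R) ^+ k.+1 = 1 - 2^-1 ^+ n.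
  by rewrite gerBl exprn_ge0.
elim: n => [|n IH]; first by rewrite big_ord0 expr0 subrr.
by rewrite big_ord_recr /= IH exprS; field.
Qed.

Lemma geom_small (c q e : R) : 0 <= q < 1 -> 0 < e ->
  exists k : nat, forall n, (k <= n)%N -> c * q ^+ n < e.
Proof.
move=> /andP[q0 q1] e0.
have h : (fun n => c * q ^+ n) @ \oo --> c * 0.
  by apply: cvgMl_tmp; apply: cvg_expr; rewrite ger0_norm.
rewrite mulr0 in h; move/cvgrPdist_lt: h => /(_ e e0) [M _ hM]; exists M => n Mn.
by have := hM n Mn; rewrite sub0r normrN; apply: le_lt_trans; exact: ler_norm.
Qed.

(** A bounded second divided difference makes b |-> f[p,b] Lipschitz, hence
    convergent as b tends to p. *)
Lemma tame_derivable D M f p r : 0 < r -> disc p r `<=` D -> tame D M f ->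
  derivable (f : R[i]^o -> R[i]^o) p 1.
Proof.
move=> r0 DD [m0 [m1 [m2 [[h0 h1 h2 _] _ _ k2]]]].
pose dd b := (f b - f p) / (b - p).
have Dp : D p by apply: DD; rewrite /disc /= subrr nrm0.
have ddle b c : b != p -> c != p -> D b -> D c ->
    nrm (dd b - dd c) <= m2 * nrm (b - c).
  move=> bp cp Db Dc.
  have b0 : b - p != 0 by rewrite subr_eq0.
  have c0 : c - p != 0 by rewrite subr_eq0.
  have P : 0 < nrm (b - p) * nrm (c - p) by rewrite mulr_gt0 ?nrm_gt0.
  rewrite -(ler_pM2r P) -!nrmM.
  have -> : (dd b - dd c) * ((b - p) * (c - p)) =
     (f p - f b) * (p - c) - (f p - f c) * (p - b).
    by rewrite /dd; field; rewrite ?b0 ?c0.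
  apply: le_trans (k2 _ _ _ Dp Db Dc) _.
  by rewrite (nrm_distC p b) (nrm_distC p c) nrmM le_eqVlt; apply/orP; left; apply/eqP; ring.
(* The derivative is the limit of the difference quotients at p + r / 2^(n+1);
   summability of their increments gives convergence. *)
pose hh n : R := (r / 2) * 2^-1 ^+ n.
have hh0 n : 0 < hh n by rewrite /hh mulr_gt0 ?exprn_gt0 ?divr_gt0 ?invr_gt0.
have hhr n : hh n < r.
  have : (2^-1 : R) ^+ n <= 1 by rewrite exprn_ile1 // ?invr_ge0 //; lra.
  rewrite /hh => t; nra.
pose pt n : R[i] := p + (hh n)%:C.
have ptp n : pt n != p.
  by rewrite -subr_eq0 /pt addrC addKr -nrm_eq0 nrm_real normr_eq0 gt_eqF.
have Dpt n : D (pt n).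
  by apply: DD; rewrite /disc /= /pt addrC addKr nrm_real gtr0_norm.
pose u n := dd (pt n.+1) - dd (pt n).
have hu n : \sum_(k < n) nrm (u k) <= m2 * (r / 2).
  apply: (@le_trans _ _ (\sum_(k < n) m2 * (r / 2) * (2^-1 : R) ^+ k.+1)).
    apply: ler_sum => k _; apply: le_trans (ddle _ _ _ _ _ _) _ => //.
    rewrite -mulrA ler_wpM2l // /pt opprD addrACA subrr add0r -rmorphB nrm_real.
    rewrite ler_norml /hh exprS.
    have q0 : 0 <= (2^-1 : R) ^+ k by rewrite exprn_ge0 // invr_ge0.
    have : 0 <= r * (2^-1 : R) ^+ k by rewrite mulr_ge0 // ltW.
    by move=> t; apply/andP; split; lra.
  rewrite -mulr_sumr ler_piMr ?geo_half_sum // mulr_ge0 // ltW //; lra.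
have [l' hl'] := abs_summable_cvg hu.
pose l := l' + dd (pt 0%N).
have ql : forall e : R, 0 < e -> exists N, forall n, (N <= n)%N -> nrm (dd (pt n) - l) < e.
  move=> e e0; move/cvgn_nrm: hl' => /(_ e e0) [N hN]; exists N => n /hN.
  suff -> : \sum_(k < n) u k - l' = dd (pt n) - l by [].
  rewrite -(big_mkord xpredT) telescope_sumr //= /l; ring.
have key b : b != p -> D b -> nrm (dd b - l) <= m2 * nrm (b - p).
  move=> bp Db; apply/ler_addgt0Pr => e e0.
  have e2 : 0 < e / 2 by lra.
  have [N1 hN1] := ql _ e2.
  have h12 : 0 <= (2^-1 : R) < 1 by apply/andP; split; lra.
  have [N2 hN2] := geom_small (m2 * (r / 2)) h12 e2.
  pose n := maxn N1 N2.
  have a1 := hN1 n (leq_maxl _ _); have a2 := hN2 n (leq_maxr _ _).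
  have -> : dd b - l = (dd b - dd (pt n)) + (dd (pt n) - l) by ring.
  apply: le_trans (nrmD _ _) _.
  have a3 := ddle b (pt n) bp (ptp n) Db (Dpt n).
  have a4 : nrm (b - pt n) <= nrm (b - p) + hh n.
    rewrite /pt opprD addrA; apply: le_trans (nrmB _ _) _.
    by rewrite nrm_real gtr0_norm.
  have a5 : m2 * nrm (b - pt n) <= m2 * nrm (b - p) + m2 * hh n.
    by rewrite -mulrDr ler_wpM2l.
  rewrite /hh mulrA in a5; lra.
apply/cvg_ex; exists l; apply/cvg_nrm => e e0.
apply/dnear_nrm; exists (Num.min r (e / (m2 + 1))).
  by rewrite lt_min r0 divr_gt0 // ltr_wpDl.
move=> h hn0; rewrite subr0 lt_min => /andP[hr he].
have hh' : (h *: (1 : R[i]^o) + p) = p + h by rewrite addrC /GRing.scale /= mulr1.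
rewrite /= hh'.
have hp : p + h != p by rewrite -subr_eq0 addrC addKr.
have Dh : D (p + h) by apply: DD; rewrite /disc /= addrC addKr.
have := key _ hp Dh; rewrite /dd [p + h - p]addrC addKr.
move=> K1; rewrite [_ *: _]mulrC; apply: le_lt_trans K1 _.
rewrite ltr_pdivlMr in he; last by rewrite ltr_wpDl.
apply: le_lt_trans he; rewrite mulrC ler_wpM2l ?nrm_ge0 //; lra.
Qed.

Lemma disc_sub p r q : disc p r q -> exists2 e, 0 < e & disc q e `<=` disc p r.
Proof.
move=> h; exists (r - nrm (q - p)); first by rewrite subr_gt0.
move=> s; rewrite /disc /= => hs.
have -> : s - p = (s - q) + (q - p) by ring.
apply: le_lt_trans (nrmD _ _) _; lra.
Qed.

Lemma holomorphic_disc (F : R[i] -> R[i]) p r : 0 < r ->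
  (forall s, disc p r s -> derivable (F : R[i]^o -> R[i]^o) s 1) -> holomorphic_at F p.
Proof. by move=> r0 h; apply/near_nrm; exists r. Qed.

Lemma tame_holomorphic M f p r : 0 < r -> tame (disc p r) M f -> holomorphic_at f p.
Proof.
move=> r0 hf; apply: (holomorphic_disc r0) => s /disc_sub [e e0 he].
exact: tame_derivable e0 he hf.
Qed.

End Deriv.

(** * The complex exponential *)

Section CExp.
Variable R : realType.
Implicit Types (z u v : R[i]).

Lemma Re_cexp z : complex.Re (cexp z) = expR (complex.Re z) * cos (complex.Im z).
Proof. by rewrite /cexp cReM /= mul0r subr0. Qed.

Lemma Im_cexp z : complex.Im (cexp z) = expR (complex.Re z) * sin (complex.Im z).
Proof. by rewrite /cexp cImM /= mul0r addr0. Qed.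

Lemma cexpD u v : cexp (u + v) = cexp u * cexp v.
Proof.
apply: complex_ext.
  rewrite Re_cexp cReM cReD cImD expRD cosD !Re_cexp !Im_cexp; ring.
rewrite Im_cexp cImM cReD cImD expRD sinD !Re_cexp !Im_cexp; ring.
Qed.

Lemma cexp0 : cexp 0 = 1 :> R[i].
Proof. by apply: complex_ext; rewrite ?Re_cexp ?Im_cexp /= expR0 mul1r ?cos0 ?sin0. Qed.

Lemma nrm_cexp z : nrm (cexp z) = expR (complex.Re z).
Proof.
rewrite /cexp nrmM nrm_real ger0_norm ?expR_ge0 //=.
by rewrite cos2Dsin2 sqrtr1 mulr1.
Qed.

Lemma cexp_neq0 z : cexp z != 0.
Proof. by rewrite -nrm_gt0 nrm_cexp expR_gt0. Qed.

Lemma cexpN z : cexp (- z) = (cexp z)^-1.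
Proof.
apply: (mulfI (cexp_neq0 z)); rewrite -cexpD subrr cexp0 mulfV //.
exact: cexp_neq0.
Qed.

Lemma cexp_natM (n : nat) z : cexp (n%:R * z) = cexp z ^+ n.
Proof.
elim: n => [|n IH]; first by rewrite mul0r cexp0.
by rewrite -natr1 mulrDl mul1r cexpD IH exprSr.
Qed.

Lemma cexp_real (x : R) : cexp x%:C = (expR x)%:C.
Proof. by apply: complex_ext; rewrite ?Re_cexp ?Im_cexp /= ?cos0 ?sin0 ?mulr1 ?mulr0. Qed.

End CExp.

Section CExpAnalysis.
Variable R : realType.
Implicit Types (z u v : R[i]).

Lemma mean_value_at0 (f df : R -> R) (y B : R) : (forall x : R, is_derive x 1 f (df x)) ->
  (forall x, `|x| <= `|y| -> `|df x| <= B) -> `|f y - f 0| <= B * `|y|.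
Proof.
move=> hf hB.
have cf (A : set R) : {within A, continuous f}.
  apply: continuous_subspaceT => x; apply: differentiable_continuous.
  by apply/derivable1_diffP; have := hf x.
have [y0|y0] := leP 0 y.
  have [c] := MVT_segment y0 (fun x _ => hf x) (cf _).
  rewrite in_itv /= => /andP[c0 cy] ->; rewrite subr0 normrM ler_wpM2r //.
  by apply: hB; rewrite !ger0_norm.
have [c] := MVT_segment (ltW y0) (fun x _ => hf x) (cf _).
rewrite in_itv /= => /andP[c0 cy] e.
rewrite distrC e sub0r normrM normrN ler_wpM2r //.
by apply: hB; rewrite !ler0_norm // ?lerN2 // ltW.
Qed.

Lemma sin_le_id (y : R) : `|sin y| <= `|y|.
Proof.
have := @mean_value_at0 sin cos y 1 (fun x => is_derive_sin x); rewrite sin0 subr0 mul1r; apply.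
by move=> x _; exact: cos_max.
Qed.

Lemma cos_sub1_bound (y : R) : `|cos y - 1| <= y ^+ 2.
Proof.
have e : cos y - 1 = - (sin (y / 2) ^+ 2 *+ 2).
  have {1}-> : y = (y / 2) *+ 2 by rewrite -mulr_natr; field.
  rewrite cos_mulr2n cos2sin2 mulrnBl; ring.
have h := sin_le_id (y / 2).
have h2 : `|sin (y / 2)| ^+ 2 <= `|y / 2| ^+ 2 by rewrite lerXn2r ?nnegrE.
rewrite !real_normK ?num_real // in h2.
rewrite e normrN ger0_norm; last by rewrite mulrn_wge0 // sqr_ge0.
rewrite -mulr_natr; have := sqr_ge0 y => h3.
apply: (@le_trans _ _ ((y / 2) ^+ 2 * 2)); first by rewrite ler_wpM2r.
by rewrite exprMn; lra.
Qed.

Lemma sin_sub_bound (y : R) : `|y| <= 1 -> `|sin y - y| <= y ^+ 2.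
Proof.
move=> y1.
have hd (x : R) : is_derive x 1 (sin \- id : R -> R) (cos x - 1) by apply: is_deriveB.
have := @mean_value_at0 _ _ y `|y| hd; rewrite /= sin0 !subr0 -expr2 real_normK ?num_real //.
apply=> x hx; apply: le_trans (cos_sub1_bound x) _.
rewrite -[x ^+ 2]real_normK ?num_real // expr2.
have := normr_ge0 x => *; nra.
Qed.

Lemma expR_bounds (x : R) : `|x| <= 1 / 2 ->
  [/\ expR x <= 2, `|expR x - 1| <= 2 * `|x| & `|expR x - 1 - x| <= 2 * x ^+ 2].
Proof.
move=> hx; have [h1 h2] : - (1/2) <= x /\ x <= 1/2.
  by move: hx; rewrite ler_norml => /andP[].
have a := expR_ge1Dx x; have b := expR_ge1Dx (- x).
have c : expR x * expR (- x) = 1 by rewrite -expRD subrr expR0.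
have p := expR_gt0 x; have q := expR_gt0 (- x).
have d : expR x * (1 - x) <= 1 by rewrite -[leRHS]c ler_wpM2l ?expR_ge0.
have e2 : expR x <= 2 by nra.
have f : expR x - 1 - x <= 2 * x ^+ 2 by nra.
have g : `|expR x - 1 - x| <= 2 * x ^+ 2 by rewrite ger0_norm //; lra.
split => //.
rewrite ler_norml; case: (lerP 0 x) => x0.
  rewrite (ger0_norm x0); apply/andP; split; nra.
rewrite (ltr0_norm x0); apply/andP; split; nra.
Qed.

Lemma cexp_bound v : nrm v <= 1 / 2 -> nrm (cexp v - 1 - v) <= 8 * nrm v ^+ 2.
Proof.
move=> hv; set a := complex.Re v; set b := complex.Im v.
have ha : `|a| <= nrm v := Re_le_nrm v.
have hb : `|b| <= nrm v := Im_le_nrm v.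
have a2 : a ^+ 2 <= nrm v ^+ 2.
  by rewrite -[a ^+ 2]real_normK ?num_real // lerXn2r ?nnegrE ?nrm_ge0.
have b2 : b ^+ 2 <= nrm v ^+ 2.
  by rewrite -[b ^+ 2]real_normK ?num_real // lerXn2r ?nnegrE ?nrm_ge0.
have [e1 e2 e3] := expR_bounds (le_trans ha hv).
have c1 := cos_sub1_bound b.
have c2 : `|sin b - b| <= b ^+ 2.
  by apply: sin_sub_bound; apply: le_trans hb _; apply: le_trans hv _; lra.
have ep := expR_gt0 a.
have ab : `|a| * `|b| <= nrm v ^+ 2 by rewrite expr2 ler_pM.
apply: le_trans (nrm_le_ReIm _) _.
rewrite !(cReD, cImD, cReN, cImN) Re_cexp Im_cexp -/a -/b /= subr0.
have -> : expR a * cos b - 1 - a = expR a * (cos b - 1) + (expR a - 1 - a) by ring.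
have -> : expR a * sin b - b = expR a * (sin b - b) + (expR a - 1) * b by ring.
have t1 : `|expR a * (cos b - 1)| <= 2 * nrm v ^+ 2.
  by rewrite normrM gtr0_norm // ler_pM ?(le_trans c1) // ltW.
have t2 : `|expR a * (sin b - b)| <= 2 * nrm v ^+ 2.
  by rewrite normrM gtr0_norm // ler_pM ?(le_trans c2) // ltW.
have t3 : `|(expR a - 1) * b| <= 2 * nrm v ^+ 2.
  rewrite normrM; apply: (@le_trans _ _ (2 * `|a| * `|b|)); first by rewrite ler_wpM2r.
  by rewrite -mulrA ler_wpM2l.
have t4 : `|expR a - 1 - a| <= 2 * nrm v ^+ 2 by lra.
have := ler_normD (expR a * (cos b - 1)) (expR a - 1 - a).
have := ler_normD (expR a * (sin b - b)) ((expR a - 1) * b).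
move=> *; lra.
Qed.

Lemma cexp_bound1 v : nrm v <= 1 / 2 -> nrm (cexp v - 1) <= 5 * nrm v.
Proof.
move=> hv; have := cexp_bound hv => h.
have -> : cexp v - 1 = (cexp v - 1 - v) + v by ring.
apply: le_trans (nrmD _ _) _; have := nrm_ge0 v => p.
rewrite expr2 in h; nra.
Qed.

(** The second divided difference of exp at 0, u, v; the case |v| <= |u|, to
    which symmetry reduces the general one. *)
Lemma cexp_dd2_aux u v : nrm u <= 1/2 -> nrm v <= nrm u -> nrm (u - v) <= 1/2 ->
  nrm ((cexp u - 1) * v - (cexp v - 1) * u) <= 100 * (nrm u * nrm v * nrm (u - v)).
Proof.
move=> hu hvu hd; have hv : nrm v <= 1/2 by lra.
(* Factor exp u = exp v * exp (u - v); every term is then of third order. *)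
set d := u - v in hd *.
have -> : (cexp u - 1) * v - (cexp v - 1) * u =
   v * cexp v * (cexp d - 1 - d) + d * (v * (cexp v - 1) - (cexp v - 1 - v)).
  have -> : cexp u = cexp v * cexp d by rewrite -cexpD /d addrC subrK.
  rewrite /d; ring.
have p := nrm_ge0 u; have q := nrm_ge0 v; have r := nrm_ge0 d.
have dle : nrm d <= 2 * nrm u by apply: le_trans (nrmB _ _) _; lra.
have b1 := cexp_bound hd; have b2 := cexp_bound hv; have b3 := cexp_bound1 hv.
have b4 : nrm (cexp v) <= 4.
  have -> : cexp v = (cexp v - 1) + 1 by ring.
  apply: le_trans (nrmD _ _) _; rewrite nrm1; lra.
have t1 : nrm (v * cexp v * (cexp d - 1 - d)) <= nrm v * 4 * (8 * nrm d ^+ 2).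
  by rewrite (nrmM (v * _)) (nrmM v) !ler_pM ?mulr_ge0 ?nrm_ge0.
have t2 : nrm (v * (cexp v - 1) - (cexp v - 1 - v)) <= 13 * nrm v ^+ 2.
  apply: le_trans (nrmB _ _) _; rewrite nrmM.
  have : nrm v * nrm (cexp v - 1) <= nrm v * (5 * nrm v) by rewrite ler_wpM2l.
  move=> *; rewrite expr2 in b2 *; lra.
have t3 : nrm (d * (v * (cexp v - 1) - (cexp v - 1 - v))) <= nrm d * (13 * nrm v ^+ 2).
  by rewrite nrmM ler_wpM2l.
have s0 : 0 <= nrm v * nrm d by rewrite mulr_ge0.
have s1 : nrm v * nrm d * nrm d <= nrm v * nrm d * (2 * nrm u) by rewrite ler_wpM2l.
have s2 : nrm v * nrm d * nrm v <= nrm v * nrm d * nrm u by rewrite ler_wpM2l.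
have s3 : 0 <= nrm v * nrm d * nrm u by rewrite mulr_ge0.
apply: le_trans (nrmD _ _) _; rewrite !expr2 in t1 t3; lra.
Qed.

Lemma cexp_dd2 u v : nrm u <= 1/2 -> nrm v <= 1/2 -> nrm (u - v) <= 1/2 ->
  nrm ((cexp u - 1) * v - (cexp v - 1) * u) <= 100 * (nrm u * nrm v * nrm (u - v)).
Proof.
move=> hu hv hd; have [h|h] := leP (nrm v) (nrm u); first exact: cexp_dd2_aux.
rewrite [X in X <= _]nrm_distC (nrm_distC u v) (mulrC (nrm u)).
by apply: cexp_dd2_aux; rewrite ?(ltW h) // nrm_distC.
Qed.

(** Translating a point to 0 multiplies exp by a constant, so that the bounds at 0
    serve everywhere on a disc of diameter 1/2. *)
Lemma cexp_tame : tame (disc 0 (1/4)) 1000 (@cexp R).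
Proof.
have dif (a b : R[i]) : disc 0 (1/4) a -> disc 0 (1/4) b -> nrm (a - b) <= 1/2.
  by rewrite /disc /= !subr0 => ha hb; apply: le_trans (nrmB _ _) _; lra.
have bd (a : R[i]) : disc 0 (1/4) a -> nrm (cexp a) <= 4.
  move=> Da; have ha : nrm a < 1/4 by move: Da; rewrite /disc /= subr0.
  have -> : cexp a = (cexp a - 1) + 1 by ring.
  have h : nrm a <= 1/2 by lra.
  apply: le_trans (nrmD _ _) _; rewrite nrm1; have := cexp_bound1 h; lra.
exists 4, 20, 400; split; [by split; lra|exact: bd| |].
- move=> a b Da Db; have -> : cexp a - cexp b = cexp b * (cexp (a - b) - 1).
    by rewrite mulrBr -cexpD [b + _]addrC subrK mulr1.
  rewrite nrmM; have := cexp_bound1 (dif _ _ Da Db) => h.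
  apply: (@le_trans _ _ (4 * (5 * nrm (a - b)))); last by lra.
  by rewrite ler_pM ?nrm_ge0 ?bd.
- move=> a b c Da Db Dc.
  have -> : (cexp a - cexp b) * (a - c) - (cexp a - cexp c) * (a - b) =
     cexp a * ((cexp (b - a) - 1) * (c - a) - (cexp (c - a) - 1) * (b - a)).
    rewrite !cexpD cexpN; field; exact: cexp_neq0.
  have hd : nrm ((b - a) - (c - a)) <= 1/2.
    by rewrite opprB addrA subrK; exact: dif.
  have := cexp_dd2 (dif _ _ Db Da) (dif _ _ Dc Da) hd.
  rewrite opprB [b - a + _]addrA subrK => h.
  rewrite nrmM (nrm_distC a b) (nrm_distC a c).
  apply: (@le_trans _ _ (4 * (100 * (nrm (b - a) * nrm (c - a) * nrm (b - c))))).
    by rewrite ler_pM ?nrm_ge0 ?bd.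
  by rewrite le_eqVlt; apply/orP; left; apply/eqP; ring.
Qed.

Lemma cexp_affine_tame (k : R[i]) p : exists r M : R,
  0 < r /\ tame (disc p r) M (fun s => cexp (k * s)).
Proof.
have K1 : 0 < 4 * (nrm k + 1) by have := nrm_ge0 k; lra.
exists (4 * (nrm k + 1))^-1, (nrm (cexp (k * p)) * ((nrm k + 1) ^+ 2 * 1000)).
split; first by rewrite invr_gt0.
apply: (@tame_ext _ _ _ (fun s => cexp (k * p) * cexp (k * s + - (k * p)))).
  by move=> s _; rewrite -cexpD [k * p + _]addrC subrK.
apply: tameZ; apply: tame_affine cexp_tame; rewrite ?lerDl //.
  by rewrite lerDr nrm_ge0.
move=> s; rewrite /disc /= subr0 -mulrBr nrmM => h.
have := nrm_ge0 k => k0; have := nrm_ge0 (s - p) => k1.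
rewrite invfM in h.
have : nrm (s - p) * (nrm k + 1) < 4^-1.
  by rewrite -ltr_pdivlMr //; lra.
nra.
Qed.

Lemma cexp_derivable (k : R[i]) s :
  derivable ((fun s => cexp (k * s)) : R[i]^o -> R[i]^o) s 1.
Proof.
have [r [M [r0 h]]] := cexp_affine_tame k s.
by apply: tame_derivable r0 _ h.
Qed.

(** The entire function (exp u - 1) / u: the factor by which 1 - exp (-L (s - p))
    differs from a multiple of s - p. *)
Definition expm1_quotient u : R[i] := if u == 0 then 1 else (cexp u - 1) / u.

Lemma expm1_quotient_mul u : u * expm1_quotient u = cexp u - 1.
Proof.
rewrite /expm1_quotient; case: eqVneq => [->|u0]; first by rewrite cexp0 mul0r subrr.
by rewrite mulrC divfK.
Qed.

Lemma expm1_quotient0 : expm1_quotient 0 = 1. Proof. by rewrite /expm1_quotient eqxx. Qed.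

Lemma expm1_quotient_tame : exists M : R, tame (disc 0 (1/4)) M expm1_quotient.
Proof.
(* Riemann sums of the integral of exp (t u) over t in [0, 1]; they are
   geometric sums, which gives both the tame bound and the limit. *)
pose th n k : R[i] := k%:R / n.+1%:R.
pose S n u : R[i] := n.+1%:R^-1 * \sum_(k < n.+1) cexp (th n k * u + 0).
have hS n : tame (disc 0 (1/4)) 1000 (S n).
  have -> : 1000 = nrm (n.+1%:R^-1 : R[i]) * \sum_(k < n.+1) (1 ^+ 2 * 1000 : R).
    by rewrite sumr_const card_ord nrmV nrm_nat expr1n mul1r -[_ *+ n.+1]mulr_natl; field.
  apply: tameZ; apply: tame_sum => k _.
  have th1 : nrm (th n k) <= 1.
    by rewrite /th nrmM nrmV !nrm_nat ler_pdivrMr ?ltr0n // mul1r ler_nat ltnW.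
  apply: tame_affine cexp_tame => //.
  move=> s; rewrite /disc /= !subr0 addr0 nrmM; apply: le_lt_trans.
  by rewrite ler_piMl ?nrm_ge0.
exists (3 * 1000); apply: (tame_lim hS) => u hu.
have [u0|u0] := eqVneq u 0.
  apply: (@dominated_cvg _ _ _ (fun=> 0) 0%N); last exact: cvg_cst.
  move=> n _; rewrite /S u0 expm1_quotient0.
  rewrite (eq_bigr (fun _ => 1)); last by move=> k _; rewrite mulr0 add0r cexp0.
  by rewrite sumr_const card_ord mulVf ?pnatr_eq0 // subrr nrm0.
apply: (@dominated_cvg _ _ _ (fun n => (1000 * 8 * nrm u) * n.+1%:R^-1) 0%N); last first.
  rewrite -(mulr0 (1000 * 8 * nrm u)); apply: cvgMl_tmp; exact: cvg_harmonic.
move=> n _; pose q := cexp (n.+1%:R^-1 * u).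
have n0 : (n.+1%:R : R[i]) != 0 by rewrite pnatr_eq0.
have n0' : 0 < (n.+1%:R : R) by rewrite ltr0n.
have eS : S n u * (n.+1%:R * (q - 1)) = cexp u - 1.
  have -> : S n u = n.+1%:R^-1 * \sum_(k < n.+1) q ^+ k.
    congr (_ * _); apply: eq_bigr => k _; by rewrite /q -cexp_natM addr0 /th -mulrA.
  have -> : cexp u = q ^+ n.+1 by rewrite /q -cexp_natM mulVKf.
  by rewrite subrX1 mulrACA mulVf // mul1r mulrC.
have un : nrm (n.+1%:R^-1 * u) = nrm u / n.+1%:R.
  by rewrite nrmM nrmV nrm_nat mulrC.
have hu2 : nrm (n.+1%:R^-1 * u) <= 1/2.
  rewrite un ler_pdivrMr //; move: hu; rewrite /disc /= subr0.
  have : (1 : R) <= n.+1%:R by rewrite ler1n.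
  move=> *; lra.
have dl : nrm (n.+1%:R * (q - 1) - u) <= 8 * nrm u ^+ 2 / n.+1%:R.
  have -> : n.+1%:R * (q - 1) - u = n.+1%:R * (q - 1 - n.+1%:R^-1 * u).
    by rewrite [RHS]mulrBr mulVKf.
  rewrite nrmM nrm_nat.
  apply: (@le_trans _ _ (n.+1%:R * (8 * (nrm u / n.+1%:R) ^+ 2))).
    by rewrite ler_wpM2l ?(ltW n0') // -un; exact: cexp_bound.
  by rewrite le_eqVlt; apply/orP; left; apply/eqP; field; rewrite gt_eqF.
have Sb : nrm (S n u) <= 1000 := tame_nrm (hS n) hu.
have u0' : 0 < nrm u by rewrite nrm_gt0.
rewrite -(ler_pM2r u0') -nrmM /expm1_quotient (negbTE u0) mulrBl divfK //.
have -> : S n u * u - (cexp u - 1) = - (S n u * (n.+1%:R * (q - 1) - u)).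
  by rewrite -eS; ring.
rewrite nrmN nrmM.
apply: (@le_trans _ _ (1000 * (8 * nrm u ^+ 2 / n.+1%:R))).
  by rewrite ler_pM ?nrm_ge0.
by rewrite le_eqVlt; apply/orP; left; apply/eqP; field; rewrite gt_eqF.
Qed.

End CExpAnalysis.

(** * Arguments and logarithms *)

Section Log.
Variable R : realType.
Implicit Types (z u v : R[i]).

Lemma cosD2pin (t : R) (n : int) : cos (t + 2 * pi * n%:~R) = cos t.
Proof.
have h m (s : R) : cos (s + 2 * pi * m%:R) = cos s.
  have -> : 2 * pi * m%:R = pi *+ 2 *+ m :> R by rewrite mulr_natl mulr_natr.
  by apply: periodicn; exact: cosD2pi.
case: n => m; first exact: h.
by rewrite NegzE mulrNz mulrN -[in RHS](subrK (2 * pi * m.+1%:R) t) h.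
Qed.

(** Reduction modulo 2 pi leaves the injectivity of cos on [0, pi], applied to
    the reduced angle or to its complement to 2 pi. *)
Lemma cos_eq1 (t : R) : cos t = 1 -> exists n : int, t = 2 * pi * n%:~R.
Proof.
have p0 := pi_gt0 R; have pp : 0 < 2 * pi :> R by rewrite mulr_gt0.
move=> ct; pose n := Num.floor (t / (2 * pi)); exists n.
have [h1 h2] : n%:~R <= t / (2 * pi) /\ t / (2 * pi) < n%:~R + 1.
  by have := floor_itv (t / (2 * pi)); rewrite intrD => /andP[].
rewrite ler_pdivlMr // in h1; rewrite ltr_pdivrMr // in h2.
pose t' := t - 2 * pi * n%:~R.
have t0 : 0 <= t' by rewrite /t'; lra.
have t2 : t' < 2 * pi by rewrite /t'; lra.
have ct' : cos t' = 1.
  by rewrite -ct -[in RHS](subrK (2 * pi * n%:~R) t) cosD2pin.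
suff : t' = 0 by rewrite /t'; lra.
have key s : 0 <= s <= pi -> cos s = 1 -> s = 0.
  move=> /andP[s0 sp] cs; apply: cos_inj.
  - by rewrite in_itv /= s0.
  - by rewrite in_itv /= lexx pi_ge0.
  - by rewrite cos0.
have [tp|tp] := leP t' pi; first by apply: key => //; rewrite t0.
have : 2 * pi - t' = 0.
  apply: key; first by apply/andP; split; lra.
  have := cosD2pin (- t') 1; by rewrite cosN ct' mulr1 addrC.
lra.
Qed.

Lemma cexp_eq1 u : cexp u = 1 -> exists n : int, u = 0 +i* (2 * pi * n%:~R).
Proof.
move=> h.
have hr : expR (complex.Re u) = 1 by rewrite -nrm_cexp h nrm1.
have r0 : complex.Re u = 0 by apply: expR_inj; rewrite hr expR0.
have : cos (complex.Im u) = 1.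
  by have := congr1 (@complex.Re R) h; rewrite Re_cexp hr mul1r.
by move=> /cos_eq1 [n hn]; exists n; apply: complex_ext.
Qed.

Lemma polar z : z != 0 -> z = cexp (ln (nrm z) +i* carg z).
Proof.
move=> z0; have n0 : 0 < nrm z by rewrite nrm_gt0.
set c := complex.Re z / nrm z.
have c1 : -1 <= c <= 1.
  by rewrite -ler_norml /c normrM normfV (gtr0_norm n0) ler_pdivrMr // mul1r Re_le_nrm.
have zz : complex.Re z ^+ 2 + complex.Im z ^+ 2 = nrm z ^+ 2.
  by case: (z) => a b /=; rewrite sqr_sqrtr // addr_ge0 // sqr_ge0.
have cs : cos (acos c) = c by rewrite acosK // in_itv /=.
have sn : sin (acos c) = `|complex.Im z| / nrm z.
  rewrite sin_acos // -[RHS]ger0_norm ?divr_ge0 ?nrm_ge0 // -sqrtr_sqr.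
  congr Num.sqrt; rewrite /c !expr_div_n real_normK ?num_real //.
  rewrite -[X in X - _](divff (lt0r_neq0 (exprn_gt0 2 n0))) -zz; ring.
apply: complex_ext; rewrite ?Re_cexp ?Im_cexp /= lnK ?posrE // /carg -/c.
  by case: ifP => _; rewrite ?cosN cs /c mulrC divfK ?gt_eqF.
case: ifP => h; rewrite ?sinN sn.
  by rewrite ger0_norm // mulrC divfK ?gt_eqF.
by rewrite ltr0_norm ?ltNge ?h // mulNr opprK mulrC divfK ?gt_eqF.
Qed.

End Log.

(** * The binomial series with a complex exponent *)

Lemma cvg_congr (T : topologicalType) (u v : nat -> T) (l : T) :
  u @ \oo --> l -> (forall n, v n = u n) -> v @ \oo --> l.
Proof. by move=> h /funext ->. Qed.

Section Binomial.
Variable R : realType.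
Implicit Types (s : R[i]) (r x y : R).

(** The coefficient of x^m in (1 + x)^(-s). *)
Definition bincoef s m : R[i] := \prod_(i < m) ((- s - i%:R) / i.+1%:R).

(** The coefficient of x^m in (1 - x)^(-r), which dominates those of
    (1 + x)^(-s) for |s| <= r. *)
Definition bincoef_maj r m : R := \prod_(i < m) ((r + i%:R) / i.+1%:R).

Lemma bincoefS s m : bincoef s m.+1 = bincoef s m * ((- s - m%:R) / m.+1%:R).
Proof. by rewrite /bincoef big_ord_recr. Qed.

Lemma bincoef_majS r m : bincoef_maj r m.+1 = bincoef_maj r m * ((r + m%:R) / m.+1%:R).
Proof. by rewrite /bincoef_maj big_ord_recr. Qed.

Lemma bincoef_maj_ge0 r m : 0 <= r -> 0 <= bincoef_maj r m.
Proof. by move=> r0; apply: prodr_ge0 => i _; rewrite divr_ge0 // addr_ge0. Qed.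

Lemma nrm_bincoef s m : nrm (bincoef s m) <= bincoef_maj (nrm s) m.
Proof.
rewrite /bincoef nrm_prod; apply: ler_prod => i _.
rewrite nrm_ge0 /= nrmM nrmV nrm_nat ler_wpM2r ?invr_ge0 //.
by apply: le_trans (nrmB _ _) _; rewrite nrmN nrm_nat.
Qed.

Lemma tame_bincoef (D : set R[i]) r m : 0 <= r -> (forall s, D s -> nrm s <= r) ->
  tame D (bincoef_maj (r + 1) m) (fun s => bincoef s m).
Proof.
move=> r0 hD; apply: tame_prod => i _.
rewrite mulrC; apply: (@tame_ext _ _ _ (fun s => i.+1%:R^-1 * (-1 * s + - i%:R))).
  by move=> s _; rewrite mulN1r mulrC.
rewrite -(nrm_nat R) -nrmV; apply: tameZ; apply: tameD.
  have -> : r + 1 = nrm (-1 : R[i]) * (r + 1) by rewrite nrmN nrm1 mul1r.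
  by apply: tameZ; exact: tame_id.
by rewrite -(nrm_nat R i) -nrmN; exact: tame_cst.
Qed.

(** The ratio test, as a bound on partial sums. *)
Lemma ratio_bounded (u : nat -> R) (q : R) N : (forall n, 0 <= u n) -> 0 <= q < 1 ->
  (forall n, (N <= n)%N -> u n.+1 <= q * u n) ->
  exists B, forall n, \sum_(k < n) u k <= B.
Proof.
move=> u0 /andP[q0 q1] h.
exists (\sum_(k < N) u k + u N / (1 - q)) => n.
have d0 : 0 < 1 - q by lra.
suff k m : \sum_(k < N + m) u k <= \sum_(k < N) u k + (u N - u (N + m)%N) / (1 - q).
  have [nN|Nn] := leqP n N.
    rewrite -(subnKC nN) big_split_ord /= -addrA lerDl addr_ge0 //.
      by apply: sumr_ge0.
    by rewrite divr_ge0 // ltW.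
  rewrite -(subnKC (ltnW Nn)); apply: le_trans (k _) _; rewrite lerD2l ler_pM2r ?invr_gt0 //.
  by rewrite gerBl.
elim: m => [|m IH]; first by rewrite addn0 subrr mul0r addr0.
rewrite addnS big_ord_recr /=; apply: le_trans (lerD IH (lexx _)) _.
rewrite -addrA lerD2l -[X in _ + X](mulfK (lt0r_neq0 d0)) -mulrDl ler_pM2r ?invr_gt0 //.
have := h (N + m)%N (leq_addr _ _); lra.
Qed.

Lemma bincoef_maj_sum r y : 0 <= r -> 0 <= y < 1 ->
  exists B, forall n, \sum_(k < n) bincoef_maj r k * y ^+ k <= B.
Proof.
move=> r0 /andP[y0 y1].
have d0 : 0 < 1 - y by lra.
pose N := (Num.truncn (2 * r / (1 - y))).+1.
apply: (@ratio_bounded (fun k => bincoef_maj r k * y ^+ k) ((1 + y) / 2) N).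
- by move=> n; rewrite mulr_ge0 ?bincoef_maj_ge0 ?exprn_ge0.
- by apply/andP; split; lra.
move=> n Nn; rewrite bincoef_majS exprS.
have b0 : 0 <= bincoef_maj r n * y ^+ n by rewrite mulr_ge0 ?bincoef_maj_ge0 ?exprn_ge0.
have -> : bincoef_maj r n * ((r + n%:R) / n.+1%:R) * (y * y ^+ n) =
  ((r + n%:R) / n.+1%:R * y) * (bincoef_maj r n * y ^+ n) by ring.
rewrite ler_wpM2r //.
have n0 : (0 : R) < n.+1%:R by rewrite ltr0n.
have hn : 2 * r / (1 - y) < n%:R.
  apply: lt_le_trans (truncnS_gt _) _; by rewrite ler_nat.
rewrite ltr_pdivrMr // in hn.
rewrite mulrAC ler_pdivrMr // -[n.+1%:R]natr1.
have ry : r * y <= r by rewrite ler_piMr // ltW.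
lra.
Qed.

(** Differentiating (1 - x)^(-r): the coefficients of the derived series are
    again of the same kind, so one summability result covers all derivatives. *)
Lemma bincoef_maj_shift r m :
  m.+1%:R * bincoef_maj r m.+1 = r * bincoef_maj (r + 1) m.
Proof.
elim: m => [|m IH]; first by rewrite /bincoef_maj big_ord_recl !big_ord0 addr0 divr1 mul1r.
rewrite bincoef_majS [bincoef_maj (r + 1) _]bincoef_majS.
have n0 : (m.+1%:R : R) != 0 by rewrite pnatr_eq0.
have n1 : (m.+2%:R : R) != 0 by rewrite pnatr_eq0.
have -> : m.+2%:R * (bincoef_maj r m.+1 * ((r + m.+1%:R) / m.+2%:R)) =
  m.+1%:R * bincoef_maj r m.+1 * ((r + m.+1%:R) / m.+1%:R).
  have := mulfV n1; have := mulfV n0; move: (m.+2%:R) (m.+1%:R) n0 n1 => a b *; field.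
  by apply/andP; split.
rewrite IH -!mulrA; congr (_ * (_ * (_ / _))); rewrite -natr1; ring.
Qed.

Lemma pseries_cvg (f : nat -> R) (c r y : R) : 0 <= c -> 0 <= r -> 0 <= y < 1 ->
  (forall i, `|f i| <= c * bincoef_maj r i) -> cvgn (pseries f y).
Proof.
move=> c0 r0 hy hf; have [B hB] := bincoef_maj_sum r0 hy.
apply: normed_cvg; apply: nondecreasing_is_cvgn.
  by apply/nondecreasing_seqP => n; rewrite /= /series /= big_nat_recr //= lerDl.
exists (c * B) => _ [n _ <-]; apply: le_trans (ler_wpM2l c0 (hB n)).
rewrite /= /series /= big_mkord mulr_sumr; apply: ler_sum => k _.
case/andP: hy => y0 _; rewrite normrM normrX (ger0_norm y0) mulrA ler_wpM2r ?exprn_ge0 //.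
Qed.

Lemma diffs_bound (f : nat -> R) (c r : R) :
  (forall i, `|f i| <= c * bincoef_maj r i) ->
  forall i, `|pseries_diffs f i| <= (c * r) * bincoef_maj (r + 1) i.
Proof.
move=> hf i; rewrite /pseries_diffs normrM ger0_norm // -mulrA -bincoef_maj_shift.
by rewrite mulrCA ler_wpM2l.
Qed.

Lemma pseries_bincoef (f : nat -> R) (r x : R) : 0 <= r -> `|x| < 1 ->
  (forall i, `|f i| <= bincoef_maj r i) ->
  [/\ cvgn (pseries f x), cvgn (pseries (pseries_diffs f) x) &
      is_derive x (1 : R) (fun x => limn (pseries f x)) (limn (pseries (pseries_diffs f) x))].
Proof.
move=> r0 x1 hf; pose y := (1 + `|x|) / 2.
have xy : `|x| < y by rewrite /y; lra.
have y0 : 0 <= y by apply: le_trans (ltW xy).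
have hy : 0 <= y < 1 by rewrite y0 /y; lra.
have hf' i : `|f i| <= 1 * bincoef_maj r i by rewrite mul1r.
have c1 := pseries_cvg ler01 r0 hy hf'.
have hd := diffs_bound hf'.
have r1 : 0 <= r + 1 by lra.
have c2 : cvgn (pseries (pseries_diffs f) y) by apply: pseries_cvg hd => //; lra.
have hdd := diffs_bound hd.
have c3 : cvgn (pseries (pseries_diffs (pseries_diffs f)) y).
  by apply: pseries_cvg hdd; rewrite ?mulr_ge0 //; lra.
have xy' : `|x| < `|y| by rewrite [`|y|]ger0_norm.
split; [exact: is_cvg_pseries_inside c1 xy'|exact: is_cvg_pseries_inside c2 xy'|].
exact: pseries_snd_diffs c1 c2 c3 xy'.
Qed.

(** The operator (1 + x) d/dx on power series, read on coefficients. *)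
Lemma pseries_euler (f g : nat -> R) (x : R) :
  cvgn (pseries (pseries_diffs f) x) -> cvgn (pseries g x) ->
  (forall m, m.+1%:R * f m.+1 + m%:R * f m = g m) ->
  (1 + x) * limn (pseries (pseries_diffs f) x) = limn (pseries g x).
Proof.
move=> cf cg h; symmetry; apply/cvg_lim => //.
have h1 := pseries_diffs_equiv cf.
have h2 : x * series (fun i => i%:R * f i * x ^+ i.-1) n @[n --> \oo] -->
    x * limn (pseries (pseries_diffs f) x) by apply: cvgMl_tmp.
rewrite mulrDl mul1r.
apply: cvg_congr; first exact: (cvgD cf h2).
move=> n /=.
rewrite fctE /pseries /series /= mulr_sumr -big_split /=; apply: eq_bigr => i _.
rewrite -h /pseries_diffs mulrDl; congr (_ + _).
by case: i => [|i]; rewrite ?mul0r ?mulr0 // exprS /=; ring.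
Qed.

Lemma zero_derive_cst (G : R -> R) (x : R) : `|x| < 1 ->
  (forall y, `|y| < 1 -> is_derive y (1 : R) G 0) -> G x = G 0.
Proof.
move=> x1 hG.
have key (a b : R) : -1 < a -> b < 1 -> a <= b -> G b = G a.
  move=> a1 b1 ab.
  have hab y : a <= y <= b -> `|y| < 1.
    by move=> /andP[ay yb]; rewrite ltr_norml; apply/andP; split; lra.
  have [|/=|c _] := @MVT_segment R G (fun=> 0) a b ab.
  - by move=> y; rewrite in_itv /= => /andP[/ltW ay /ltW yb]; apply: hG; apply: hab; rewrite ay.
  - apply: derivable_within_continuous => y; rewrite in_itv /= => hy.
    by have := hG y (hab _ hy) => -[].
  by rewrite mul0r => /eqP; rewrite subr_eq0 => /eqP.
move: x1; rewrite ltr_norml => /andP[h1 h2].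
have [x0|x0] := leP 0 x; first by apply: key => //; lra.
by symmetry; apply: key => //; lra.
Qed.

Lemma binomial_series s (x : R) : `|x| < 1 ->
  (fun n => \sum_(m < n) bincoef s m * (x%:C) ^+ m : R[i]^o) @ \oo -->
  (cexp (- s * (ln (1 + x))%:C) : R[i]^o).
Proof.
(* Multiplied by (1 + x)^s, the sum U + i V has derivative 0, because the
   recurrence of the coefficients reads (1 + x) (U + i V)' = - s (U + i V).
   G1 and G2 below are the real and imaginary parts of this product. *)
pose u m := complex.Re (bincoef s m); pose v m := complex.Im (bincoef s m).
pose sg := complex.Re s; pose ta := complex.Im s.
have hu i : `|u i| <= bincoef_maj (nrm s) i := le_trans (Re_le_nrm _) (nrm_bincoef _ _).
have hv i : `|v i| <= bincoef_maj (nrm s) i := le_trans (Im_le_nrm _) (nrm_bincoef _ _).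
have s0 := nrm_ge0 s.
have rec m : m.+1%:R * bincoef s m.+1 + m%:R * bincoef s m = - s * bincoef s m.
  rewrite bincoefS; field; by rewrite addrC natr1 pnatr_eq0.
have recc m : m.+1%:R * u m.+1 + m%:R * u m = - sg * u m + ta * v m /\
              m.+1%:R * v m.+1 + m%:R * v m = - sg * v m - ta * u m.
  have hn k : k%:R = (k%:R)%:C :> R[i] by rewrite rmorph_nat.
  have := rec m; rewrite !hn => e; split.
    have := congr1 (@complex.Re R) e; rewrite cReD !cReM cReN cImN /= -/(u _) -/(v _) -/(u _) -/(v _) -/sg -/ta.
    move=> {e}e; lra.
  have := congr1 (@complex.Im R) e; rewrite cImD !cImM cReN cImN /= -/(u _) -/(v _) -/(u _) -/(v _) -/sg -/ta.
  move=> {e}e; lra.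
pose U (y : R) := limn (pseries u y); pose V (y : R) := limn (pseries v y).
pose dU (y : R) := limn (pseries (pseries_diffs u) y).
pose dV (y : R) := limn (pseries (pseries_diffs v) y).
have lin (y a b : R) : `|y| < 1 ->
    pseries (fun m => a * u m + b * v m) y @ \oo --> a * U y + b * V y.
  move=> y1; have [cu _ _] := pseries_bincoef s0 y1 hu.
  have [cv _ _] := pseries_bincoef s0 y1 hv.
  apply: cvg_congr; first exact: (cvgD (cvgMl_tmp (a := a) cu) (cvgMl_tmp (a := b) cv)).
  move=> n /=.
  by rewrite fctE /pseries /series /= !mulr_sumr -big_split /=; apply: eq_bigr => i _; ring.
have ode (y : R) : `|y| < 1 -> (1 + y) * dU y = - sg * U y + ta * V y /\
               (1 + y) * dV y = - ta * U y - sg * V y.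
  move=> y1; have [_ cu _] := pseries_bincoef s0 y1 hu.
  have [_ cv _] := pseries_bincoef s0 y1 hv; split.
    have l := lin y (- sg) ta y1; rewrite -(cvg_lim _ l) //.
    apply: pseries_euler => //; first by apply/cvg_ex; eexists; exact: l.
    by move=> m; have [] := recc m.
  have l := lin y (- ta) (- sg) y1; rewrite -[RHS](_ : - ta * U y + - sg * V y = _); last by ring.
  rewrite -(cvg_lim _ l) //.
  apply: pseries_euler => //; first by apply/cvg_ex; eexists; exact: l.
  by move=> m; have [_ ->] := recc m; ring.
pose L (y : R) := ln (1 + y).
pose E (y : R) := expR (sg * L y).
pose c (y : R) := cos (ta * L y).
pose d (y : R) := sin (ta * L y).
pose G1 y := E y * (c y * U y - d y * V y).
pose G2 y := E y * (d y * U y + c y * V y).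
have der (y : R) : `|y| < 1 -> is_derive y (1 : R) G1 0 /\ is_derive y (1 : R) G2 0.
  move=> y1; have py : 0 < 1 + y by move: y1; rewrite ltr_norml => /andP[]; lra.
  have [_ _ iU] := pseries_bincoef s0 y1 hu.
  have [_ _ iV] := pseries_bincoef s0 y1 hv.
  have [ho1 ho2] := ode y y1.
  have il : is_derive y (1 : R) L ((1 + y)^-1).
    have i1 : is_derive y (1 : R) (fun y : R => 1 + y) 1.
      have := is_deriveD (is_derive_cst (1 : R) y (1 : R)) (is_derive_id y (1 : R)).
      by rewrite add0r.
    have := is_derive1_comp (is_derive1_ln py) i1; by rewrite mulr1.
  have im (k : R) : is_derive y (1 : R) (fun y => k * L y) (k * (1 + y)^-1).
    exact: (is_deriveZ k il).
  have iE : is_derive y (1 : R) E (E y * (sg * (1 + y)^-1)).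
    exact: (is_derive1_comp (is_derive_expR _) (im sg)).
  have ic : is_derive y (1 : R) c (- d y * (ta * (1 + y)^-1)).
    exact: (is_derive1_comp (is_derive_cos _) (im ta)).
  have isn : is_derive y (1 : R) d (c y * (ta * (1 + y)^-1)).
    exact: (is_derive1_comp (is_derive_sin _) (im ta)).
  have p0 : 1 + y != 0 by rewrite gt_eqF.
  have eU : dU y = (- sg * U y + ta * V y) / (1 + y) by rewrite -ho1 mulrAC mulfV // mul1r.
  have eV : dV y = (- ta * U y - sg * V y) / (1 + y) by rewrite -ho2 mulrAC mulfV // mul1r.
  split.
    have := is_deriveM iE (is_deriveB (is_deriveM ic iU) (is_deriveM isn iV)).
    rewrite -/(U y) -/(V y) -/(dU y) -/(dV y) eU eV => h.
    apply: is_derive_eq h _; rewrite /GRing.scale /=; rewrite -[X in _ + X * _]/(c y * U y - d y * V y); field.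
    exact: p0.
  have := is_deriveM iE (is_deriveD (is_deriveM isn iU) (is_deriveM ic iV)).
  rewrite -/(U y) -/(V y) -/(dU y) -/(dV y) eU eV => h.
  apply: is_derive_eq h _; rewrite /GRing.scale /=; rewrite -[X in _ + X * _]/(d y * U y + c y * V y); field.
  exact: p0.
move=> x1.
have at0 (f : nat -> R) : limn (pseries f 0) = f 0%N.
  apply/cvg_lim => //; apply: cvg_near_cst; exists 1%N => // n /= n1.
  rewrite /pseries /series /= big_ltn // expr0 mulr1.
  by rewrite big_nat big1 ?addr0 // => i /andP[i0 _]; rewrite expr0n gtn_eqF // mulr0.
have U0 : U 0 = 1 by rewrite /U at0 /u /bincoef big_ord0.
have V0 : V 0 = 0 by rewrite /V at0 /v /bincoef big_ord0.
have e1 : G1 x = 1.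
  rewrite (zero_derive_cst x1 (fun y hy => (der y hy).1)) /G1 U0 V0 /E /c /L addr0 ln1 !mulr0.
  by rewrite expR0 cos0 subr0 !mulr1.
have e2 : G2 x = 0.
  rewrite (zero_derive_cst x1 (fun y hy => (der y hy).2)) /G2 U0 V0 /E /d /L addr0 ln1 !mulr0.
  by rewrite expR0 sin0 mul0r addr0 mulr0.
have key : cexp (- s * (L x)%:C) = U x +i* V x.
  have : cexp (s * (L x)%:C) * (U x +i* V x) = 1.
    have h1 : complex.Re (s * (L x)%:C) = sg * L x by rewrite cReM /= mulr0 subr0.
    have h2 : complex.Im (s * (L x)%:C) = ta * L x by rewrite cImM /= mulr0 add0r.
    apply: complex_ext.
      rewrite cReM Re_cexp Im_cexp h1 h2 /= -e1 /G1 /E /c /d; ring.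
    rewrite cImM Re_cexp Im_cexp h1 h2 /= -e2 /G2 /E /c /d; ring.
  by rewrite mulNr cexpN => e; rewrite -[RHS](mulKf (cexp_neq0 (s * (L x)%:C))) e mulr1.
rewrite -/(L x) key.
have [cu _ _] := pseries_bincoef s0 x1 hu.
have [cv _ _] := pseries_bincoef s0 x1 hv.
move/cvgrPdist_lt: cu => cu; move/cvgrPdist_lt: cv => cv.
apply/cvgn_nrm => e e0; have e20 : 0 < e / 2 by lra.
have [N1 _ h1] := cu _ e20; have [N2 _ h2] := cv _ e20.
exists (maxn N1 N2) => n; rewrite geq_max => /andP[n1 n2].
apply: le_lt_trans (nrm_le_ReIm _) _; rewrite cReD cImD cReN cImN /=.
have xr m : (x%:C) ^+ m = (x ^+ m)%:C by rewrite rmorphXn.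
have sRe : complex.Re (\sum_(k < n) bincoef s k * (x%:C) ^+ k) = pseries u x n.
  rewrite /pseries /series /= big_mkord; elim/big_rec2: _ => [|i a b _ <-] //.
  by rewrite cReD cReM xr /= mulr0 subr0.
have sIm : complex.Im (\sum_(k < n) bincoef s k * (x%:C) ^+ k) = pseries v x n.
  rewrite /pseries /series /= big_mkord; elim/big_rec2: _ => [|i a b _ <-] //.
  by rewrite cImD cImM xr /= mulr0 add0r.
rewrite sRe sIm [e]splitr ltrD // distrC; [exact: h1|exact: h2].
Qed.

End Binomial.

(** * Binet's formula *)

Lemma sum_coef_widen (K : pzRingType) (q : seq K) n (F : nat -> K) : (size q <= n)%N ->
  \sum_(i < size q) q`_i * F i = \sum_(i < n) q`_i * F i.
Proof.
move=> h; rewrite -(subnKC h) big_split_ord /= [X in _ + X]big1 ?addr0 //.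
by move=> i _; rewrite nth_default ?mul0r // leq_addr.
Qed.

Lemma size_prod_linear (K : idomainType) (I : Type) (s : seq I) (Q : pred I) (c d : I -> K) :
  (size (\prod_(i <- s | Q i) (c i *: ('X - (d i)%:P)))%R <= (count Q s).+1)%N.
Proof.
elim: s => [|i s IH]; first by rewrite big_nil size_poly1.
rewrite big_cons /=; case: (Q i) => //=; rewrite add1n.
apply: leq_trans (size_polyMleq _ _) _.
have : (size (c i *: ('X - (d i)%:P))%R <= 2)%N.
  by apply: leq_trans (size_scale_leq _ _) _; rewrite size_XsubC.
by move=> h; have := leq_add h IH; rewrite -subn1 leq_subLR add1n.
Qed.

Section Functional.
Variables (K : fieldType) (a : nat -> int).

(** The linear form X^n |-> a_(n+1); it starts at a_1, since a_0 is arbitrary. *)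
Definition seq_form (q : {poly K}) : K := \sum_(i < size q) q`_i * (a i.+1)%:~R.

Lemma seq_form_widen n (q : {poly K}) : (size q <= n)%N ->
  seq_form q = \sum_(i < n) q`_i * (a i.+1)%:~R.
Proof. exact: (@sum_coef_widen _ _ _ (fun i => (a i.+1)%:~R)). Qed.

Lemma seq_formD p q : seq_form (p + q) = seq_form p + seq_form q.
Proof.
rewrite !(@seq_form_widen (maxn (size p) (size q))) ?leq_maxl ?leq_maxr ?size_polyD //.
by rewrite -big_split /=; apply: eq_bigr => i _; rewrite coefD mulrDl.
Qed.

Lemma seq_formZ c q : seq_form (c *: q) = c * seq_form q.
Proof.
rewrite (@seq_form_widen (size q)) ?size_scale_leq // /seq_form mulr_sumr.
by apply: eq_bigr => i _; rewrite coefZ mulrA.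
Qed.

Lemma seq_form0 : seq_form 0 = 0.
Proof. by rewrite /seq_form size_poly0 big_ord0. Qed.

Lemma seq_form_sum (I : Type) (s : seq I) (F : I -> {poly K}) :
  seq_form (\sum_(i <- s) F i) = \sum_(i <- s) seq_form (F i).
Proof.
by elim: s => [|i s IH]; rewrite ?big_nil ?seq_form0 // !big_cons seq_formD IH.
Qed.

Lemma seq_formB p q : seq_form (p - q) = seq_form p - seq_form q.
Proof. by rewrite seq_formD -scaleN1r seq_formZ mulN1r. Qed.

Lemma seq_form_XnM n q : seq_form ('X^n * q) = \sum_(i < size q) q`_i * (a (n + i).+1)%:~R.
Proof.
have h : (size ('X^n * q)%R <= n + size q)%N.
  by apply: leq_trans (size_polyMleq _ _) _; rewrite size_polyXn addSn.
rewrite (seq_form_widen h) big_split_ord /= big1 ?add0r; last first.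
  by move=> i _; rewrite coefXnM ltn_ord mul0r.
by apply: eq_bigr => i _; rewrite coefXnM ltnNge leq_addr /= addKn.
Qed.

Lemma seq_form_Xn n : seq_form 'X^n = (a n.+1)%:~R.
Proof. by rewrite -['X^n]mulr1 seq_form_XnM size_poly1 big_ord1 coef1 mul1r addn0. Qed.

Variables (P : {poly int}).
Hypothesis P_ann : annihilates P a.
Let PK : {poly K} := map_poly intr P.

Lemma seq_form_Xn_ann n : P \is monic -> seq_form ('X^n * PK) = 0.
Proof.
move=> Pm; rewrite seq_form_XnM /PK size_map_poly_id0; last first.
  by rewrite (monicP Pm) mulr1z oner_eq0.
rewrite [RHS](_ : _ = (\sum_(i < size P) P`_i * a (n.+1 + i)%N)%:~R); last by rewrite P_ann.
rewrite rmorph_sum; apply: eq_bigr => i _.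
by rewrite coef_map_id0 // rmorphM addSn.
Qed.

Lemma seq_form_mul_ann q : P \is monic -> seq_form (q * PK) = 0.
Proof.
move=> Pm; rewrite -[q]coefK poly_def mulr_suml seq_form_sum big1 // => i _.
by rewrite -scalerAl seq_formZ seq_form_Xn_ann ?mulr0.
Qed.

End Functional.

Section Binet.
Variables (R : realType) (a : nat -> int) (P : {poly int}) (r : nat) (alpha : nat -> R[i]).
Hypothesis P_min : is_minimal_polynomial P a.
Hypothesis P_irr : irreducible_poly (map_poly intr P : {poly rat}).
Hypothesis P_deg : size P = r.+1.
Hypothesis P_roots : map_poly intr P = \prod_(1 <= i < r.+1) ('X - (alpha i)%:P).
Hypothesis a1_pos : 0 < a 1%N.

Local Notation C := R[i].
Let PQ : {poly rat} := map_poly intr P.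
Let PC : {poly C} := map_poly intr P.
Let Pm : P \is monic. Proof. by case: P_min. Qed.
Let Pann : annihilates P a. Proof. by case: P_min. Qed.

Lemma size_PQ : size PQ = r.+1.
Proof. by rewrite size_map_poly_id0 ?P_deg // (monicP Pm) mulr1z oner_eq0. Qed.

Lemma PC_ratr : PC = map_poly ratr PQ.
Proof. by rewrite /PC /PQ -map_poly_comp; apply: eq_map_poly => x /=; rewrite ratr_int. Qed.

Lemma coprime_small (q : {poly rat}) : q != 0 -> (size q <= r)%N -> coprimep PQ q.
Proof.
move=> q0 sq; rewrite irreducible_poly_coprime //; apply: contraTN sq => /dvdp_leq h.
by rewrite -ltnNge -size_PQ; exact: h.
Qed.

Lemma degree_gt0 : (0 < r)%N.
Proof. by case: P_irr; rewrite size_PQ. Qed.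

Lemma alpha_uniq : uniq [seq alpha i | i <- index_iota 1 r.+1].
Proof.
rewrite -separable_prod_XsubC big_map -P_roots -/PC PC_ratr separable_map separable_poly.unlock.
apply: coprime_small.
  apply/eqP => /(congr1 (fun q : {poly rat} => q`_r.-1)) /eqP.
  have rr : r = r.-1.+1 by rewrite prednK ?degree_gt0.
  rewrite coef_deriv coef0 -rr.
  have -> : PQ`_r = 1.
    have := monicP Pm; rewrite /lead_coef P_deg /= => h.
    by rewrite /PQ coef_map_id0 // h mulr1z.
  by rewrite pnatr_eq0 => /eqP r0; have := degree_gt0; rewrite r0.
by rewrite -ltnS -size_PQ lt_size_deriv // irredp_neq0.
Qed.

(** The Hankel matrix of the sequence has integer entries, so its determinant
    vanishes over C exactly when it does over the rationals; there irreducibility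
    of P excludes a nonzero annihilating polynomial of degree < r. *)
Lemma hankel_nondeg (q : {poly C}) : q != 0 -> (size q <= r)%N ->
  (forall j, seq_form a ('X^j * q) = 0) -> False.
Proof.
move=> q0 sq hq.
pose H : 'M[rat]_r := \matrix_(i, j) (a (j + i).+1)%:~R.
have dC : \det (map_mx ratr H : 'M[C]_r) == 0.
  apply/det0P; exists (poly_rV q).
    apply: contra q0 => /eqP h; rewrite -(poly_rV_K sq) h; apply/eqP.
    exact: linear0.
  apply/rowP => j; rewrite !mxE -[RHS](hq j) seq_form_XnM.
  rewrite (@sum_coef_widen _ _ _ (fun i => (a (j + i).+1)%:~R) sq).
  by apply: eq_bigr => i _; rewrite !mxE ratr_int.
rewrite det_map_mx fmorph_eq0 in dC.
have /det0P [w w0 wH] := dC.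
pose p := rVpoly w.
have p0 : p != 0.
  by apply: contra w0 => /eqP h; rewrite -(rVpolyK w) -/p h; apply/eqP/linear0.
have sp : (size p <= r)%N := size_poly _ _.
have hp j : (j < r)%N -> seq_form a ('X^j * p) = 0.
  move=> jr; have /rowP/(_ (Ordinal jr)) := wH; rewrite !mxE => h.
  rewrite seq_form_XnM -[RHS]h.
  rewrite (@sum_coef_widen _ _ _ (fun i => (a (j + i).+1)%:~R) sp).
  by apply: eq_bigr => i _; rewrite !mxE coef_rVpoly_ord.
have /Bezout_eq1_coprimepP [[u v] /= uv] := coprime_small p0 sp.
(* Reducing the Bezout coefficient modulo P keeps its degree below r, the
   range in which p is known to annihilate the sequence. *)
have e : v %% PQ * p = 1 - (u + v %/ PQ * p) * PQ.
  by rewrite -uv {2}(divp_eq v PQ); ring.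
have s1 : seq_form a (v %% PQ * p) = (a 1%N)%:~R.
  by rewrite e seq_formB seq_form_mul_ann // subr0 -(expr0 'X) seq_form_Xn.
have s0 : seq_form a (v %% PQ * p) = 0.
  rewrite -[v %% PQ]coefK poly_def mulr_suml seq_form_sum big1 // => i _.
  rewrite -scalerAl seq_formZ hp ?mulr0 //.
  apply: leq_trans (ltn_ord i) _; rewrite -ltnS -size_PQ ltn_modp.
  exact: irredp_neq0.
by move: a1_pos; rewrite s0 in s1; move/eqP: s1; rewrite eq_sym intr_eq0 => /eqP ->.
Qed.

(** The roots are distinct, so vanishing at all of them means being a multiple
    of P. *)
Lemma ann_roots (q : {poly C}) : (forall i, (1 <= i < r.+1)%N -> q.[alpha i] = 0) ->
  seq_form a q = 0.
Proof.
move=> h.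
have hr : all (root q) [seq alpha i | i <- index_iota 1 r.+1].
  rewrite all_map; apply/allP => i; rewrite mem_index_iota => hi.
  by apply/rootP; exact: h.
have [|p ->] := uniq_roots_prod_XsubC hr; first by rewrite uniq_rootsE alpha_uniq.
by rewrite big_map -P_roots seq_form_mul_ann.
Qed.

Let lagrange i : {poly C} := \prod_(1 <= j < r.+1 | j != i) ((alpha i - alpha j)^-1 *: ('X - (alpha j)%:P)).

Lemma alpha_inj i j : (1 <= i < r.+1)%N -> (1 <= j < r.+1)%N -> i != j ->
  alpha i - alpha j != 0.
Proof.
move=> hi hj; apply: contra; rewrite subr_eq0 => /eqP e.
have sz : size [seq alpha i | i <- index_iota 1 r.+1] = r.
  by rewrite size_map size_iota subSS subn0.
have e1 k : (1 <= k < r.+1)%N -> nth 0 [seq alpha i | i <- index_iota 1 r.+1] k.-1 = alpha k.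
  move=> /andP[k0 kr].
  have kk : (k.-1 < r)%N by rewrite prednK.
  by rewrite (nth_map 0%N) ?size_iota ?subSS ?subn0 // nth_iota ?subSS ?subn0 // add1n prednK.
have hi' : (i.-1 < r)%N by lia.
have hj' : (j.-1 < r)%N by lia.
have := nth_uniq 0 (s := [seq alpha i | i <- index_iota 1 r.+1]) (i := i.-1) (j := j.-1).
rewrite sz => /(_ hi' hj' alpha_uniq); rewrite !e1 // e eqxx => /esym /eqP ij.
by apply/eqP; lia.
Qed.

Lemma lagrange_eval i j : (1 <= i < r.+1)%N -> (1 <= j < r.+1)%N ->
  (lagrange i).[alpha j] = (i == j)%:R.
Proof.
move=> hi hj; rewrite /lagrange horner_prod; case: eqVneq => [<-|ij] /=.
  rewrite big_seq_cond big1 // => k; rewrite mem_index_iota => /andP[hk ki].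
  by rewrite !hornerE mulVf // alpha_inj // eq_sym.
apply/eqP; rewrite prodf_seq_eq0; apply/hasP; exists j; first by rewrite mem_index_iota.
by rewrite eq_sym ij !hornerE subrr mulr0 eqxx.
Qed.

(** The form takes X^n to a_(n+1), whence the division by alpha_i. *)
Definition binet_coef i : C := seq_form a (lagrange i) / alpha i.

(** X^(n-1) and its Lagrange interpolant at the roots have the same image under
    the form.  From n = 2 on, a root equal to 0 is harmless. *)
Lemma binet n : (2 <= n)%N ->
  (a n)%:~R = \sum_(1 <= i < r.+1) binet_coef i * alpha i ^+ n :> C.
Proof.
case: n => // -[//|n] _.
have h : seq_form a ('X^(n.+1) - \sum_(1 <= i < r.+1) alpha i ^+ n.+1 *: lagrange i) = 0.
  apply: ann_roots => j hj; rewrite hornerD hornerN horner_sum hornerXn.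
  rewrite (bigD1_seq j) ?mem_index_iota ?iota_uniq //= hornerZ lagrange_eval // eqxx mulr1.
  rewrite big_seq_cond big1 ?addr0 ?subrr // => k; rewrite mem_index_iota => /andP[hk kj].
  by rewrite hornerZ lagrange_eval // (negbTE kj) mulr0.
move: h; rewrite seq_formB seq_form_Xn seq_form_sum => /eqP; rewrite subr_eq0 => /eqP ->.
apply: eq_bigr => i _; rewrite seq_formZ /binet_coef.
have [->|a0] := eqVneq (alpha i) 0; first by rewrite !exprS !mul0r !mulr0.
by rewrite [alpha i ^+ n.+2]exprS mulrA divfK // mulrC.
Qed.

(** The Lagrange polynomial at alpha_1 is an eigenvector modulo P of the
    multiplication by X; if the form vanished on it, it would annihilate the
    sequence. *)
Lemma binet_coef1_neq0 : alpha 1%N != 0 -> binet_coef 1 != 0.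
Proof.
move=> a0; rewrite mulf_neq0 ?invr_neq0 //; apply/eqP => h0.
have h1 : (1 <= 1 < r.+1)%N by rewrite /= ltnS degree_gt0.
apply: (@hankel_nondeg (lagrange 1)).
- apply/eqP => h; have := lagrange_eval h1 h1; rewrite h horner0 eqxx => /eqP.
  by rewrite eq_sym oner_eq0.
- apply: leq_trans (size_prod_linear _ _ _ _) _.
  have := count_predC (pred1 1%N) (index_iota 1 r.+1).
  rewrite size_iota subSS subn0 count_uniq_mem ?iota_uniq // mem_index_iota h1 add1n => h; by rewrite -[X in (_ <= X)%N]h.
- move=> j; have : seq_form a ('X^j * lagrange 1 - alpha 1%N ^+ j *: lagrange 1) = 0.
    apply: ann_roots => i hi; rewrite hornerD hornerN hornerM hornerZ hornerXn lagrange_eval //.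
    by case: eqVneq => [<-|_]; rewrite ?mulr0 subrr.
  by rewrite seq_formB seq_formZ h0 mulr0 subr0.
Qed.

End Binet.

(** * Holomorphic functions and isolated singularities *)

Section Holo.
Variable R : realType.
Local Notation C := (R[i]^o).
Implicit Types (f g : R[i] -> R[i]) (p : R[i]).

Lemma derivable_cont f p : derivable (f : C -> C) p 1 -> {for p, continuous (f : C -> C)}.
Proof. by move=> h; apply: differentiable_continuous; apply/derivable1_diffP. Qed.

Lemma holo_derivable f p : holomorphic_at f p -> derivable (f : C -> C) p 1.
Proof. exact: nbhs_singleton. Qed.

Lemma holo_cont f p : holomorphic_at f p -> {for p, continuous (f : C -> C)}.
Proof. by move/holo_derivable/derivable_cont. Qed.

Lemma holo_all f p : (forall s, derivable (f : C -> C) s 1) -> holomorphic_at f p.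
Proof. by move=> h; rewrite /holomorphic_at; near=> s; exact: h.
Unshelve. all: by end_near. Qed.

Lemma holo_ext f g p : (forall s, f s = g s) -> holomorphic_at g p -> holomorphic_at f p.
Proof. by move=> /funext ->. Qed.

Lemma holo_cst (c : R[i]) p : holomorphic_at (fun=> c) p.
Proof. by apply: holo_all => s; exact: derivable_cst. Qed.

Lemma holo_id p : holomorphic_at id p.
Proof. by apply: holo_all => s; exact: derivable_id. Qed.

Lemma holo_lift2 f g (F : R[i] -> R[i]) p :
  (forall s, derivable (f : C -> C) s 1 -> derivable (g : C -> C) s 1 ->
    derivable (F : C -> C) s 1) ->
  holomorphic_at f p -> holomorphic_at g p -> holomorphic_at F p.
Proof.
move=> H /near_nrm [e e0 h] /near_nrm [e' e'0 h'].
apply/near_nrm; exists (Num.min e e'); first by rewrite lt_min e0.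
by move=> s; rewrite lt_min => /andP[hs hs']; apply: H; [exact: h|exact: h'].
Qed.

Lemma holoD f g p : holomorphic_at f p -> holomorphic_at g p ->
  holomorphic_at (fun s => f s + g s) p.
Proof. by apply: holo_lift2 => s hf hg; exact: (derivableD hf hg). Qed.

Lemma holoM f g p : holomorphic_at f p -> holomorphic_at g p ->
  holomorphic_at (fun s => f s * g s) p.
Proof. by apply: holo_lift2 => s hf hg; exact: (derivableM hf hg). Qed.

Lemma holoX f p n : holomorphic_at f p -> holomorphic_at (fun s => f s ^+ n) p.
Proof.
move=> hf; elim: n => [|n IH]; first exact: holo_cst.
by apply: holo_ext (holoM hf IH) => s; rewrite exprS.
Qed.

Lemma holo_sum (I : Type) (s : seq I) (P : pred I) (F : I -> R[i] -> R[i]) p :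
  (forall i, P i -> holomorphic_at (F i) p) ->
  holomorphic_at (fun x => \sum_(i <- s | P i) F i x) p.
Proof.
move=> h; elim: s => [|i s IH].
  by apply: holo_ext (holo_cst 0 p) => x; rewrite big_nil.
case: (boolP (P i)) => Pi; last first.
  by apply: holo_ext (IH) => x; rewrite big_cons (negbTE Pi).
by apply: holo_ext (holoD (h i Pi) IH) => x; rewrite big_cons Pi.
Qed.

Lemma cont_near_neq f p (c : R[i]) : {for p, continuous (f : C -> C)} -> f p != c ->
  \forall s \near (p : C), f s != c.
Proof.
move=> hc fp.
have e0 : 0 < nrm (f p - c) by rewrite nrm_gt0 subr_eq0.
have h0 : \forall s \near (p : C), nrm (f s - f p) < nrm (f p - c).
  exact: (proj1 (cvg_nrm (nbhs_filter (p : C)) (f : C -> C) (f p)) hc _ e0).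
move/near_nrm: h0 => [e e1 h].
apply/near_nrm; exists e => // s /h.
by apply: contraTneq => ->; rewrite nrm_distC ltxx.
Qed.

Lemma holoV f p : holomorphic_at f p -> f p != 0 -> holomorphic_at (fun s => (f s)^-1) p.
Proof.
move=> hf fp; have := cont_near_neq (holo_cont hf) fp.
move=> /near_nrm [e e0 h]; move: hf => /near_nrm [e' e'0 h'].
apply/near_nrm; exists (Num.min e e'); first by rewrite lt_min e0.
move=> s; rewrite lt_min => /andP[hs hs']; apply: derivableV; [exact: h|exact: h'].
Qed.

Lemma holo_near_eq f g p : (\forall s \near (p : C), f s = g s) ->
  holomorphic_at g p -> holomorphic_at f p.
Proof.
move=> /near_nrm [e e0 h] /near_nrm [e' e'0 h'].
apply/near_nrm; exists (Num.min e e'); first by rewrite lt_min e0.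
move=> s; rewrite lt_min => /andP[hs hs'].
have gf : \forall t \near (s : C), g t = f t.
  have [u u0 hu] := disc_sub hs; apply/near_nrm; exists u => // t /hu; symmetry; exact: h.
apply: near_eq_derivable; [exact: gf|exact: h'].
Qed.

Lemma holo_horner (q : {poly R[i]}) p : holomorphic_at (fun s => q.[s]) p.
Proof.
elim/poly_ind: q => [|q c IH].
  by apply: holo_ext (holo_cst 0 p) => s; rewrite horner0.
apply: holo_ext (holoD (holoM IH (holo_id p)) (holo_cst c p)) => s.
by rewrite hornerMXaddC.
Qed.

Lemma holo_cexp (k c : R[i]) p : holomorphic_at (fun s => cexp (k * s + c)) p.
Proof.
have h : holomorphic_at (fun s => cexp (k * s)) p.
  by apply: holo_all => s; exact: cexp_derivable.
by apply: holo_ext (holoM h (holo_cst (cexp c) p)) => s; rewrite cexpD.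
Qed.

Lemma cvg_dnbhs_nrm f p (l : C) : (f : C -> C) @ (p : C)^' --> l <->
  forall e : R, 0 < e -> exists2 u : R, 0 < u &
    forall s, s != p -> nrm (s - p) < u -> nrm (f s - l) < e.
Proof.
split=> h.
  move=> e e0; apply/dnear_nrm.
  exact: (proj1 (cvg_nrm (dnbhs_filter (p : C)) (f : C -> C) l) h e e0).
apply: (proj2 (cvg_nrm (dnbhs_filter (p : C)) (f : C -> C) l)) => e e0.
by apply/dnear_nrm; exact: h.
Qed.

Lemma cont_nrm f p : {for p, continuous (f : C -> C)} ->
  forall e : R, 0 < e -> exists2 u : R, 0 < u &
    forall s, nrm (s - p) < u -> nrm (f s - f p) < e.
Proof.
move=> hf e e0; apply/near_nrm.
exact: (proj1 (cvg_nrm (nbhs_filter (p : C)) (f : C -> C) (f p)) hf e e0).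
Qed.

Lemma cont_punct f g p : {for p, continuous (g : C -> C)} ->
  (\forall s \near (p : C)^', f s = g s) -> (f : C -> C) @ (p : C)^' --> (g p : C).
Proof.
move=> hg /dnear_nrm [u u0 hu]; apply/cvg_dnbhs_nrm => e e0.
have [v v0 hv] := cont_nrm hg e0.
exists (Num.min u v); first by rewrite lt_min u0.
by move=> s sp; rewrite lt_min => /andP[su sv]; rewrite hu //; exact: hv.
Qed.

Lemma cont_punct_eq f g p : {for p, continuous (f : C -> C)} ->
  {for p, continuous (g : C -> C)} ->
  (\forall s \near (p : C)^', f s = g s) -> f p = g p.
Proof.
move=> hf hg h.
have hff : \forall s \near (p : C)^', f s = f s by apply/dnear_nrm; exists 1.
have h1 := cont_punct hf hff; have h2 := cont_punct hg h.
exact: (@cvg_unique C _ _ _ _ _ h1 h2).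
Qed.

(** Fills removable singularities: near such a point the values are those of the
    holomorphic extension. *)
Definition regularize f : R[i] -> R[i] := fun p => lim ((f : C -> C) @ (p : C)^').

Lemma regularizeE f g p : {for p, continuous (g : C -> C)} ->
  (\forall s \near (p : C)^', f s = g s) -> regularize f p = g p.
Proof. by move=> hg h; apply: (@cvg_lim C) => //; exact: cont_punct. Qed.

(** A punctured neighborhood is a neighborhood of each of its points. *)
Lemma dnear_join (p : C) (P : set C) : (\forall s \near p^', P s) ->
  \forall s \near p^', \forall t \near s, P t.
Proof.
move=> /dnear_nrm [e e0 h]; apply/dnear_nrm; exists e => // s sp hs.
have sp0 : 0 < nrm (s - p) by rewrite nrm_gt0 subr_eq0.
apply/near_nrm; exists (Num.min (nrm (s - p)) (e - nrm (s - p))).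
  by rewrite lt_min sp0 subr_gt0.
move=> t; rewrite lt_min => /andP[h1 h2]; apply: h.
  by apply: contraTneq h1 => ->; rewrite nrm_distC ltxx.
have -> : t - p = (t - s) + (s - p) by ring.
by apply: le_lt_trans (nrmD _ _) _; lra.
Qed.

Lemma regularize_punct f g p : (\forall s \near (p : C)^', f s = g s) ->
  (\forall s \near (p : C)^', {for s, continuous (g : C -> C)}) ->
  \forall s \near (p : C)^', regularize f s = g s.
Proof.
move=> /dnear_join; apply: filterS2 => s h hg.
by apply: regularizeE hg _; exact: cvg_within.
Qed.

Lemma regularize_removable f g p : holomorphic_at g p ->
  (\forall s \near (p : C)^', f s = g s) ->
  (\forall s \near (p : C), regularize f s = g s).
Proof.
move=> hg h.
have hc : \forall s \near (p : C)^', {for s, continuous (g : C -> C)}.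
  by apply: cvg_within; apply: filterS hg => s; exact: derivable_cont.
have /dnear_nrm [e e0 k] := regularize_punct h hc.
apply/near_nrm; exists e => // s hs; have [->|sp] := eqVneq s p; last exact: k.
exact: regularizeE (holo_cont hg) h.
Qed.

Lemma regularize_quotient f h p : holomorphic_at h p ->
  (\forall s \near (p : C)^', f s = h s / (s - p)) ->
  \forall s \near (p : C)^', regularize f s = h s / (s - p).
Proof.
move=> hh e; apply: (regularize_punct e).
have : \forall s \near (p : C)^', s != p by apply/dnear_nrm; exists 1.
have : \forall s \near (p : C)^', derivable (h : C -> C) s 1 by exact: cvg_within.
apply: filterS2 => s hs sp; apply: derivable_cont.
have d1 : derivable ((fun t => t - p) : C -> C) s 1.
  exact: (derivableD (@derivable_id _ C s 1) (@derivable_cst _ C C (- p) s 1)).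
have n1 : s - p != 0 by rewrite subr_eq0.
exact: (derivableM hs (derivableV n1 d1)).
Qed.

Lemma regularize_pole f h p : holomorphic_at h p -> h p != 0 ->
  (\forall s \near (p : C)^', f s = h s / (s - p)) ->
  is_pole 1 (regularize f) p.
Proof.
move=> hh hp e; split => //; exists h; split => //.
by have := regularize_quotient hh e; apply: filterS => s ->; rewrite expr1.
Qed.

(** A pole of order m would make g (s - p)^m continuous with a nonzero value
    at p. *)
Lemma pole_removable f g m p : holomorphic_at g p ->
  (\forall s \near (p : C)^', f s = g s) -> is_pole m f p -> False.
Proof.
move=> hg e [m0 [k [hk kp hf]]].
have : k p = g p * (p - p) ^+ m.
  have hX : holomorphic_at (fun s => g s * (s - p) ^+ m) p.
    exact: (holoM hg (holoX _ (holoD (holo_id p) (holo_cst (- p) p)))).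
  apply: (cont_punct_eq (holo_cont hk) (holo_cont hX)).
  have : \forall s \near (p : C)^', s != p by apply/dnear_nrm; exists 1.
  move: e hf; apply: filterS3 => s -> -> sp.
  by rewrite divfK // expf_neq0 // subr_eq0.
by rewrite subrr expr0n gtn_eqF // mulr0 => k0; rewrite k0 eqxx in kp.
Qed.

Lemma pole_order1 f h m p : holomorphic_at h p ->
  (\forall s \near (p : C)^', f s = h s / (s - p)) -> is_pole m f p -> m = 1%N.
Proof.
move=> hg e [m0 [k [hk kp hf]]].
case: m m0 hf => // -[//|m] _ hf; exfalso.
have : k p = h p * (p - p) ^+ m.+1.
  have hX : holomorphic_at (fun s => h s * (s - p) ^+ m.+1) p.
    exact: (holoM hg (holoX _ (holoD (holo_id p) (holo_cst (- p) p)))).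
  apply: (cont_punct_eq (holo_cont hk) (holo_cont hX)).
  have : \forall s \near (p : C)^', s != p by apply/dnear_nrm; exists 1.
  move: e hf; apply: filterS3 => s e1 e2 sp.
  have sp0 : s - p != 0 by rewrite subr_eq0.
  have : k s = f s * (s - p) ^+ m.+2 by rewrite e2 divfK // expf_neq0.
  by rewrite e1 => ->; rewrite [_ ^+ m.+2]exprS mulrA divfK.
by rewrite subrr expr0n mulr0 => k0; rewrite k0 eqxx in kp.
Qed.

End Holo.

(** * Expansion and continuation of the Dirichlet series *)

Section Geometric.
Variable R : realType.

Lemma geo_sum_cvg (w : R[i]) : nrm w < 1 ->
  (fun n => \sum_(k < n) w ^+ k : R[i]^o) @ \oo --> ((1 - w)^-1 : R[i]^o).
Proof.
move=> w1.
have w0 : 1 - w != 0.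
  by rewrite subr_eq0 eq_sym; apply: contraTneq w1 => ->; rewrite nrm1 ltxx.
apply: (@dominated_cvg _ _ _ (fun n => (nrm (1 - w))^-1 * nrm w ^+ n) 0%N).
  move=> n _; rewrite -nrmV -nrmX -nrmM -nrmN le_eqVlt; apply/orP; left; apply/eqP; congr nrm.
  have e : \sum_(k < n) w ^+ k = (1 - w)^-1 * (1 - w ^+ n).
    by apply: (mulfI w0); rewrite mulVKf // -[RHS]opprB subrX1 -mulNr opprB.
  by rewrite e; ring.
rewrite -(mulr0 (nrm (1 - w))^-1); apply: cvgMl_tmp; apply: cvg_expr.
by rewrite ger0_norm ?nrm_ge0.
Qed.

(** The partial sums of the geometric series are tame with bound 2. *)
Lemma tame_geo (D : set R[i]) (f : R[i] -> R[i]) : tame D 2^-1 f ->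
  tame D 6 (fun s => (1 - f s)^-1).
Proof.
move=> hf; have -> : 6 = 3 * 2 :> R by ring.
apply: (@tame_lim _ _ _ (fun n s => \sum_(k < n) f s ^+ k)); last first.
  move=> s Ds; apply: geo_sum_cvg; apply: le_lt_trans (tame_nrm hf Ds) _; lra.
move=> n; apply: (@tame_le _ _ (\sum_(k < n) 2^-1 ^+ k)); last first.
  by apply: tame_sum => k _; exact: tameX.
have : \sum_(k < n.+1) (2^-1 : R) ^+ k <= 2.
  by rewrite big_ord_recl /= expr0; have := geo_half_sum R n; lra.
by rewrite big_ord_recr /=; apply: le_trans; rewrite lerDl exprn_ge0 // invr_ge0.
Qed.

End Geometric.

Lemma cvg_sum_seq (R : realType) (J : eqType) (js : seq J) (f : J -> nat -> R[i]) (l : J -> R[i]) :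
  (forall j, j \in js -> (fun k => f j k : R[i]^o) @ \oo --> (l j : R[i]^o)) ->
  (fun k => \sum_(j <- js) f j k : R[i]^o) @ \oo --> (\sum_(j <- js) l j : R[i]^o).
Proof.
elim: js => [|j js IH] h.
  rewrite big_nil; have h0 : (fun=> 0 : R[i]^o) @ \oo --> (0 : R[i]^o) by exact: cvg_cst.
  by apply: cvg_congr h0 _ => k; rewrite big_nil.
rewrite big_cons.
have h1 : (fun k => f j k + \sum_(j <- js) f j k : R[i]^o) @ \oo -->
    (l j + \sum_(j <- js) l j : R[i]^o).
  apply: cvgD; first by apply: h; rewrite mem_head.
  by apply: IH => i hi; apply: h; rewrite in_cons hi orbT.
by apply: cvg_congr h1 _ => k; rewrite big_cons.
Qed.

Section Main.
Variables (R : realType) (I : finType) (d beta : I -> R[i]) (b : nat -> R).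
Variables (z : R[i]) (A C1 : R) (N : nat).
Hypothesis z0 : z != 0.
Hypothesis A1 : 1 < A.
Hypothesis C10 : 0 < C1.
Hypothesis beta1 : forall i, nrm (beta i) < 1.
Let y : R := \sum_i nrm (d i) * nrm (beta i) ^+ N.
Hypothesis y1 : y < 1.
Hypothesis N0 : (0 < N)%N.
Hypothesis b_exp : forall n, (N <= n)%N ->
  (b n)%:C = (C1 * A ^+ n)%:C * (1 + \sum_i d i * beta i ^+ n).
Local Notation C := (R[i]^o).

Let L := ln A.
Lemma L_gt0 : 0 < L. Proof. exact: ln_gt0. Qed.

(** z A^(-s), the ratio of the main geometric series. *)
Definition geo_ratio s : R[i] := z * cexp (- L%:C * s).

Lemma geo_ratio_neq0 s : geo_ratio s != 0.
Proof. by rewrite mulf_neq0 // cexp_neq0. Qed.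

(** Words of length m in the index set I encode the monomials in the expansion
    of an m-th power of a sum over I, without multinomial coefficients. *)
Definition word_prod m (f : I -> R[i]) (t : {ffun 'I_m -> I}) : R[i] := \prod_(l < m) f (t l).

Lemma word_prod_pow m (n : nat) :
  (\sum_i d i * beta i ^+ n) ^+ m = \sum_(t : {ffun 'I_m -> I}) word_prod d t * word_prod beta t ^+ n.
Proof.
rewrite -[X in _ ^+ X]card_ord -prodr_const bigA_distr_bigA /=.
by apply: eq_bigr => t _; rewrite big_split /= prodrXl.
Qed.

Lemma y_ge0 : 0 <= y.
Proof. by apply: sumr_ge0 => i _; rewrite mulr_ge0 ?exprn_ge0 ?nrm_ge0. Qed.

Lemma word_prod_pow_nrm m :
  \sum_(t : {ffun 'I_m -> I}) nrm (word_prod d t) * nrm (word_prod beta t) ^+ N = y ^+ m.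
Proof.
rewrite -[X in _ ^+ X]card_ord -prodr_const bigA_distr_bigA /=.
by apply: eq_bigr => t _; rewrite big_split /= prodrXl !nrm_prod.
Qed.

Definition word_sum m s : R[i] := \sum_(t : {ffun 'I_m -> I})
  word_prod d t * word_prod beta t ^+ N / (1 - geo_ratio s * word_prod beta t).

Definition binomial_term m s : R[i] := bincoef s m * word_sum m s.

Definition binomial_total s : C := lim ((fun k => \sum_(m < k) binomial_term m s : C) @ \oo).

(** Denominators that vanish contribute 0; the genuine continuation is the
    regularization of this function. *)
Definition lerch_continuation s : R[i] :=
  \sum_(1 <= n < N) z ^+ n * cpow (b n) (- s) +
  cpow C1 (- s) * geo_ratio s ^+ N * binomial_total s.

Lemma ratio_bound : exists2 th : R, 0 <= th < 1 & forall i, nrm (beta i) <= th.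
Proof.
exists (\big[Num.max/0]_i nrm (beta i)).
  apply/andP; split; first by elim/big_rec: _ => // i u _ h; rewrite le_max h orbT.
  by elim/big_rec: _ => // i u _ h; rewrite gt_max beta1 h.
by move=> i; rewrite (bigD1 i) //= le_max lexx.
Qed.

Lemma word_prod_beta_le (th : R) m (t : {ffun 'I_m -> I}) : 0 <= th ->
  (forall i, nrm (beta i) <= th) -> nrm (word_prod beta t) <= th ^+ m.
Proof.
move=> th0 h; rewrite /word_prod nrm_prod -[X in _ ^+ X]card_ord -prodr_const.
by apply: ler_prod => l _; rewrite nrm_ge0 h.
Qed.

Lemma word_prod_beta_le1 m (t : {ffun 'I_m -> I}) : nrm (word_prod beta t) <= 1.
Proof.
by rewrite -(expr1n _ m); apply: word_prod_beta_le => // i; exact: ltW.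
Qed.

(** Long words have small products, so that all their denominators are inverted
    by geometric series of ratio at most 1/2, with one bound for the whole tail. *)
Lemma tail_tame p : exists (r B : R) (M : nat) (H : R[i] -> R[i]),
  [/\ 0 < r, tame (disc p r) B H &
    forall s, disc p r s -> binomial_total s = \sum_(m < M) binomial_term m s + H s /\
      (fun k => \sum_(m < k) binomial_term m s : C) @ \oo --> (binomial_total s : C)].
Proof.
have [r [Me [r0 he]]] := cexp_affine_tame (- L%:C) p.
have hb : tame (disc p r) (nrm z * Me) geo_ratio by apply: tameZ.
have K0 := tame_ge0 hb.
have [th /andP[th0 th1] hth] := ratio_bound.
have half0 : 0 < 2^-1 :> R by rewrite invr_gt0.
have [M hM] := geom_small (nrm z * Me) (introT andP (conj th0 th1)) half0.
pose rho := nrm p + r.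
have rho0 : 0 <= rho by rewrite addr_ge0 ?nrm_ge0 // ltW.
have hrho s : disc p r s -> nrm s <= rho.
  rewrite /disc /= => hs; rewrite -[s](subrK p) addrC; apply: le_trans (nrmD _ _) _.
  by rewrite lerD2l ltW.
have rho1 : 0 <= rho + 1 by lra.
have [B hB] := bincoef_maj_sum rho1 (introT andP (conj y_ge0 y1)).
have tT m : (M <= m)%N -> tame (disc p r) (bincoef_maj (rho + 1) m * (6 * y ^+ m)) (binomial_term m).
  move=> Mm; apply: tameM; first exact: tame_bincoef.
  rewrite -word_prod_pow_nrm mulrC mulr_suml; apply: tame_sum => t _.
  rewrite -nrmX -nrmM; apply: tameZ; apply: tame_geo.
  apply: (@tame_le _ _ (nrm z * Me * nrm (word_prod beta t))).
    apply: le_trans (ltW (hM m Mm)); rewrite ler_wpM2l //; exact: word_prod_beta_le.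
  apply: tameM => //; exact: tame_cst.
have hmaj k : \sum_(m < k) bincoef_maj (rho + 1) (M + m) * (6 * y ^+ (M + m)) <= 6 * B.
  apply: (@le_trans _ _ (6 * \sum_(m < M + k) bincoef_maj (rho + 1) m * y ^+ m)).
    rewrite big_split_ord /= mulrDr -[leLHS]add0r lerD //.
      rewrite mulr_ge0 //; apply: sumr_ge0 => i _.
      by rewrite mulr_ge0 ?bincoef_maj_ge0 ?exprn_ge0 ?y_ge0.
    by rewrite mulr_sumr; apply: ler_sum => i _; rewrite mulrCA.
  by rewrite ler_wpM2l.
have tS k : tame (disc p r) (6 * B) (fun s => \sum_(m < k) binomial_term (M + m) s).
  apply: tame_le (hmaj k) _.
  by apply: tame_sum => m _; apply: tT; exact: leq_addr.
have cv s : disc p r s -> exists l : C, (fun k => \sum_(m < k) binomial_term (M + m) s : C) @ \oo --> l.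
  move=> Ds; apply: (@abs_summable_cvg _ (fun m => binomial_term (M + m) s) (6 * B)) => k.
  apply: le_trans (hmaj k); apply: ler_sum => m _; apply: tame_nrm Ds.
  by apply: tT; exact: leq_addr.
pose H s : C := lim ((fun k => \sum_(m < k) binomial_term (M + m) s : C) @ \oo).
have hH s : disc p r s -> (fun k => \sum_(m < k) binomial_term (M + m) s : C) @ \oo --> H s.
  by move=> Ds; apply/cvg_ex; exact: cv.
have cvT s : disc p r s ->
    (fun k => \sum_(m < k) binomial_term m s : C) @ \oo --> (\sum_(m < M) binomial_term m s + H s : C).
  move=> Ds; rewrite -(cvg_shiftn M) /=.
  have h1 : (fun k => \sum_(m < M) binomial_term m s + \sum_(m < k) binomial_term (M + m) s : C) @ \oo -->
      (\sum_(m < M) binomial_term m s + H s : C).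
    by apply: cvgD; [exact: cvg_cst|exact: hH].
  by apply: cvg_congr h1 _ => k; rewrite addnC big_split_ord.
exists r, (3 * (6 * B)), M, H; split => //.
  exact: tame_lim tS hH.
move=> s Ds; have e : binomial_total s = \sum_(m < M) binomial_term m s + H s.
  by apply: (@cvg_lim C) => //; exact: cvT.
by split=> //; rewrite e; exact: cvT.
Qed.

Lemma binomial_total_cvg s : (fun k => \sum_(m < k) binomial_term m s : C) @ \oo --> (binomial_total s : C).
Proof.
have [r [B [M [H [r0 _ h]]]]] := tail_tame s.
by have [] := h s _; rewrite // /disc /= subrr nrm0.
Qed.

Lemma cpow_nat (n : nat) s : z ^+ n * cpow (A ^+ n) (- s) = geo_ratio s ^+ n.
Proof.
rewrite /geo_ratio exprMn; congr (_ * _); rewrite -cexp_natM /cpow lnXn ?(lt_trans ltr01 A1) //.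
by congr cexp; rewrite -/L raddfMn /= mulr_natl; ring.
Qed.

Lemma cpowM (u v : R) s : 0 < u -> 0 < v -> cpow (u * v) s = cpow u s * cpow v s.
Proof. by move=> u0 v0; rewrite /cpow lnM // rmorphD /= mulrDr cexpD. Qed.

(** The binomial series needs a real number; the sum over i is one because the
    b n are. *)
Lemma eps_real n : (N <= n)%N -> exists e : R,
  [/\ e%:C = \sum_i d i * beta i ^+ n, `|e| <= y, `|e| < 1 & b n = C1 * A ^+ n * (1 + e)].
Proof.
move=> Nn; have P0 : C1 * A ^+ n != 0.
  by rewrite mulf_neq0 ?gt_eqF ?exprn_gt0 // (lt_trans ltr01).
pose e := b n / (C1 * A ^+ n) - 1; exists e.
have P1 : (C1 * A ^+ n)%:C != 0 :> R[i] by rewrite -nrm_eq0 nrm_real normr_eq0.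
have he : e%:C = \sum_i d i * beta i ^+ n.
  apply: (addrI 1); rewrite -(rmorph1 (real_complex R)) -rmorphD /= /e addrCA subrr addr0.
  by apply: (mulfI P1); rewrite rmorph1 -b_exp // -rmorphM /= mulrC divfK.
have ley : `|e| <= y.
  rewrite -nrm_real he; apply: le_trans (nrm_sum _ _ _) _.
  apply: ler_sum => i _; rewrite nrmM nrmX ler_wpM2l ?nrm_ge0 //.
  by rewrite ler_wiXn2l ?nrm_ge0 // ltW.
split => //; first exact: le_lt_trans ley y1.
by rewrite /e addrCA subrr addr0 mulrC divfK.
Qed.

(** Truncated geometric sums differ from full ones by a term in |W(s)|^K, so the
    partial sums up to K approach the continuation geometrically fast. *)
Lemma dirichlet_cvg s : nrm (geo_ratio s) < 1 ->
  (fun K => \sum_(1 <= n < K.+1) z ^+ n * cpow (b n) (- s) : C) @ \oo --> (lerch_continuation s : C).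
Proof.
move=> bs1; pose q := nrm (geo_ratio s).
have q0 : 0 <= q := nrm_ge0 _.
have [B hB] := bincoef_maj_sum (nrm_ge0 s) (introT andP (conj y_ge0 y1)).
have B0 : 0 <= B by have := hB 0%N; rewrite big_ord0.
pose D := nrm (cpow C1 (- s)) * (B / (1 - q)).
have wb m (t : {ffun 'I_m -> I}) : nrm (geo_ratio s * word_prod beta t) <= q.
  by rewrite nrmM ler_piMr ?word_prod_beta_le1.
have n1 m (t : {ffun 'I_m -> I}) : 1 - geo_ratio s * word_prod beta t != 0.
  rewrite subr_eq0 eq_sym; apply: contraTneq (le_lt_trans (wb m t) bs1) => ->.
  by rewrite nrm1 ltxx.
have fin K : (N <= K)%N ->
    nrm (\sum_(N <= n < K) z ^+ n * cpow (b n) (- s) -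
         cpow C1 (- s) * geo_ratio s ^+ N * binomial_total s) <= D * q ^+ K.
  move=> NK.
  pose X m := bincoef s m * \sum_(t : {ffun 'I_m -> I})
    word_prod d t * ((geo_ratio s * word_prod beta t) ^+ K / (1 - geo_ratio s * word_prod beta t)).
  have step m : \sum_(N <= n < K) geo_ratio s ^+ n * (bincoef s m * (\sum_i d i * beta i ^+ n) ^+ m)
      = geo_ratio s ^+ N * binomial_term m s - X m.
    rewrite (eq_bigr (fun n => bincoef s m * \sum_(t : {ffun 'I_m -> I})
       word_prod d t * (geo_ratio s * word_prod beta t) ^+ n)); last first.
      move=> n _; rewrite word_prod_pow mulrCA; congr (_ * _); rewrite mulr_sumr.
      by apply: eq_bigr => t _; rewrite [(geo_ratio s * _) ^+ n]exprMn mulrCA.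
    rewrite -mulr_sumr exchange_big /= /binomial_term /X mulrCA -mulrBr; congr (_ * _).
    rewrite /word_sum mulr_sumr -sumrB; apply: eq_bigr => t _.
    rewrite -mulr_sumr; set w := geo_ratio s * word_prod beta t.
    have -> : \sum_(N <= n < K) w ^+ n = (w ^+ N - w ^+ K) / (1 - w).
      have h1 : 1 - w != 0 by exact: n1.
      have -> : \sum_(N <= n < K) w ^+ n = w ^+ N * \sum_(k < K - N) w ^+ k.
        rewrite -{1}[N]add0n big_addn big_mkord mulr_sumr.
        by apply: eq_bigr => k _; rewrite addnC exprD.
      apply: (mulIf h1); rewrite divfK // -mulrA.
      have -> : w ^+ K = w ^+ N * w ^+ (K - N) by rewrite -exprD subnKC.
      have := subrX1 w (K - N) => e.
      have -> : w ^+ N - w ^+ N * w ^+ (K - N) = - (w ^+ N * (w ^+ (K - N) - 1)) by ring.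
      by rewrite e; ring.
    by rewrite [w ^+ N]exprMn; ring.
  (* The expansion of the finitely many terms N <= n < K, whose geometric sums
     leave an error of order q ^+ K. *)
  have lim1 : (fun k => cpow C1 (- s) * (geo_ratio s ^+ N * (\sum_(m < k) binomial_term m s) - \sum_(m < k) X m) : C)
      @ \oo --> (\sum_(N <= n < K) z ^+ n * cpow (b n) (- s) : C).
    have h n : (N <= n)%N ->
       (fun k => cpow C1 (- s) * (geo_ratio s ^+ n * \sum_(m < k) bincoef s m * (\sum_i d i * beta i ^+ n) ^+ m) : C)
       @ \oo --> (z ^+ n * cpow (b n) (- s) : C).
      move=> Nn; have [e [<- ey e1 ->]] := eps_real Nn.
      have A0 : 0 < A ^+ n by rewrite exprn_gt0 // (lt_trans ltr01).
      have e0 : 0 < 1 + e by move: e1; rewrite ltr_norml => /andP[]; lra.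
      rewrite cpowM ?mulr_gt0 // cpowM // [cpow C1 _ * _]mulrC -mulrA mulrA cpow_nat [cpow C1 _ * _]mulrC.
      rewrite mulrA [_ * cpow C1 _]mulrC.
      apply: cvgMl_tmp; apply: cvgMl_tmp.
      exact: binomial_series.
    have : (fun k => \sum_(N <= n < K)
        (cpow C1 (- s) * (geo_ratio s ^+ n * \sum_(m < k) bincoef s m * (\sum_i d i * beta i ^+ n) ^+ m)) : C)
       @ \oo --> (\sum_(N <= n < K) z ^+ n * cpow (b n) (- s) : C).
      apply: cvg_sum_seq => n; rewrite mem_index_iota => /andP[Nn _]; exact: h.
    move=> hh; apply: cvg_congr hh _ => k.
    rewrite -mulr_sumr; congr (_ * _).
    rewrite (eq_bigr (fun n => \sum_(m < k) geo_ratio s ^+ n * (bincoef s m * (\sum_i d i * beta i ^+ n) ^+ m))); last first.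
      by move=> n _; rewrite mulr_sumr.
    by rewrite exchange_big /= mulr_sumr -sumrB; apply: eq_bigr => m _; rewrite step.
  have lim2 : (fun k => cpow C1 (- s) * (geo_ratio s ^+ N * (\sum_(m < k) binomial_term m s) - \sum_(m < k) X m) -
        cpow C1 (- s) * (geo_ratio s ^+ N * (\sum_(m < k) binomial_term m s)) : C)
      @ \oo --> (\sum_(N <= n < K) z ^+ n * cpow (b n) (- s) -
         cpow C1 (- s) * geo_ratio s ^+ N * binomial_total s : C).
    apply: cvgB lim1 _; rewrite -mulrA; apply: cvgMl_tmp; apply: cvgMl_tmp; exact: binomial_total_cvg.
  apply: (cvgn_nrm_le lim2) => k.
  rewrite mulrBr addrAC subrr add0r nrmN (nrmM (cpow C1 (- s))) /D -[leRHS]mulrA.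
  rewrite ler_wpM2l ?nrm_ge0 //.
  apply: le_trans (nrm_sum _ _ _) _.
  have d0 : 0 < 1 - q by rewrite subr_gt0.
  apply: (@le_trans _ _ ((\sum_(m < k) bincoef_maj (nrm s) m * y ^+ m) * (q ^+ K / (1 - q)))); last first.
    rewrite mulrAC -mulrA ler_wpM2r //; first by rewrite divr_ge0 ?exprn_ge0 // ltW.
  rewrite mulr_suml; apply: ler_sum => m _.
  rewrite /X nrmM -mulrA ler_pM ?nrm_ge0 ?nrm_bincoef //.
  rewrite -word_prod_pow_nrm mulr_suml; apply: le_trans (nrm_sum _ _ _) _.
  apply: ler_sum => t _; rewrite (nrmM (word_prod d t)) -[leRHS]mulrA ler_wpM2l ?nrm_ge0 //.
  rewrite nrmM nrmX nrmV mulrA; apply: ler_pM.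
  - by rewrite exprn_ge0 ?nrm_ge0.
  - by rewrite invr_ge0 nrm_ge0.
  - rewrite (nrmM (geo_ratio s)) exprMn mulrC ler_wpM2r ?exprn_ge0 //.
    by rewrite ler_wiXn2l ?nrm_ge0 // word_prod_beta_le1.
  - rewrite lef_pV2 ?posrE ?nrm_gt0 //.
    have := nrmD (1 - geo_ratio s * word_prod beta t) (geo_ratio s * word_prod beta t).
    by rewrite subrK nrm1; have := wb m t; lra.
apply: (@dominated_cvg _ _ _ (fun K => D * q ^+ K.+1) N).
  move=> K NK; have NK1 : (N <= K.+1)%N by exact: leqW.
  rewrite (big_cat_nat N0 NK1) /= /lerch_continuation.
  by rewrite [X in nrm X](_ : _ = \sum_(N <= n < K.+1) z ^+ n * cpow (b n) (- s) -
         cpow C1 (- s) * geo_ratio s ^+ N * binomial_total s) ?fin //; ring.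
rewrite -(mulr0 D); apply: cvgMl_tmp.
have := @cvg_expr R q; rewrite ger0_norm // => /(_ bs1).
by rewrite -(cvg_shiftS (fun K => q ^+ K)).
Qed.

Lemma holo_cpow (t : R) p : holomorphic_at (fun s => cpow t (- s)) p.
Proof.
apply: holo_ext (holo_cexp (- (ln t)%:C) 0 p) => s.
by rewrite /cpow addr0 mulNr mulNr mulrC.
Qed.

Lemma holo_geo_ratio p : holomorphic_at geo_ratio p.
Proof.
apply: holo_ext (holoM (holo_cst z p) (holo_cexp (- L%:C) 0 p)) => s.
by rewrite addr0.
Qed.

(** The coefficient as a polynomial in s: a zero at p can then be factored out. *)
Definition binpoly m : {poly R[i]} := \prod_(i < m) ((- 'X - i%:R%:P) * (i.+1%:R^-1)%:P).

Lemma binpolyE m s : (binpoly m).[s] = bincoef s m.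
Proof.
by rewrite /binpoly horner_prod; apply: eq_bigr => i _; rewrite !hornerE.
Qed.

Lemma holo_expm1_quotient p : holomorphic_at (fun s => expm1_quotient (- L%:C * s + L%:C * p)) p.
Proof.
have [M hM] := expm1_quotient_tame R.
have L0 := L_gt0.
have r0 : 0 < (4 * (L + 1))^-1 by rewrite invr_gt0; lra.
apply: (@tame_holomorphic _ ((L + 1) ^+ 2 * M) _ _ _ r0).
apply: tame_affine hM; [|by lra|].
  by rewrite nrmN nrm_real gtr0_norm //; lra.
move=> s; rewrite /disc /= subr0 => h.
have -> : - L%:C * s + L%:C * p = L%:C * (p - s) by ring.
rewrite nrmM nrm_real gtr0_norm // nrm_distC.
rewrite invfM in h.
have : nrm (s - p) * (L + 1) < 4^-1 by rewrite -ltr_pdivlMr //; lra.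
have := nrm_ge0 (s - p); nra.
Qed.

(** All denominators 1 - W(s) beta_t that vanish at p equal
    1 - exp (-L (s - p)), so the singular parts add up to a single quotient
    q(s) k(s) / (s - p).  Either q(p) = 0 and the quotient extends, or the pole is
    simple. *)
Lemma local_structure p :
  (exists g, [/\ holomorphic_at g p, \forall s \near (p : C)^', lerch_continuation s = g s &
     (forall m (t : {ffun 'I_m -> I}), geo_ratio p * word_prod beta t != 1) -> lerch_continuation p = g p]) \/
  (exists h, [/\ holomorphic_at h p, h p != 0,
     \forall s \near (p : C)^', lerch_continuation s = h s / (s - p) &
     exists m (t : {ffun 'I_m -> I}), geo_ratio p * word_prod beta t = 1]).
Proof.
have [r [B [M [H [r0 tH hH]]]]] := tail_tame p.
pose bad m (t : {ffun 'I_m -> I}) := geo_ratio p * word_prod beta t == 1.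
pose D0 s := \sum_(1 <= n < N) z ^+ n * cpow (b n) (- s).
pose k1 s := cpow C1 (- s) * geo_ratio s ^+ N.
pose G m s := \sum_(t : {ffun 'I_m -> I} | ~~ bad m t)
  word_prod d t * word_prod beta t ^+ N * (1 - geo_ratio s * word_prod beta t)^-1.
pose qc m := \sum_(t : {ffun 'I_m -> I} | bad m t) word_prod d t * word_prod beta t ^+ N.
pose q : {poly R[i]} := \sum_(m < M) binpoly m * (qc m)%:P.
pose E s := expm1_quotient (- L%:C * s + L%:C * p).
pose k s := k1 s * (L%:C * E s)^-1.
pose g0 s := D0 s + k1 s * (\sum_(m < M) (binpoly m).[s] * G m s + H s).
have Lc0 : L%:C != 0 :> R[i] by rewrite -nrm_eq0 nrm_real normr_eq0 gt_eqF ?L_gt0.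
have Ep : E p = 1 by rewrite /E mulNr addNr expm1_quotient0.
have hD0 : holomorphic_at D0 p.
  by apply: holo_sum => n _; exact: (holoM (holo_cst _ p) (holo_cpow (b n) p)).
have hk1 : holomorphic_at k1 p by exact: (holoM (holo_cpow C1 p) (holoX N (holo_geo_ratio p))).
have hG m : holomorphic_at (G m) p.
  apply: holo_sum => t bt.
  have h1 : holomorphic_at (fun s => 1 + (- word_prod beta t) * geo_ratio s) p.
    exact: (holoD (holo_cst 1 p) (holoM (holo_cst (- word_prod beta t) p) (holo_geo_ratio p))).
  have h2 : 1 + (- word_prod beta t) * geo_ratio p != 0.
    by rewrite mulNr subr_eq0 eq_sym mulrC.
  apply: holo_ext (holoM (holo_cst (word_prod d t * word_prod beta t ^+ N) p) (holoV h1 h2)) => s.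
  by rewrite mulNr [word_prod beta t * geo_ratio s]mulrC.
have hE : holomorphic_at E p by exact: holo_expm1_quotient.
have hLE : holomorphic_at (fun s => L%:C * E s) p by exact: (holoM (holo_cst L%:C p) hE).
have LEp : L%:C * E p != 0 by rewrite Ep mulr1.
have hk : holomorphic_at k p := holoM hk1 (holoV hLE LEp).
have kp : k p != 0.
  by rewrite /k mulf_neq0 ?invr_neq0 // /k1 mulf_neq0 ?expf_neq0 ?geo_ratio_neq0 // cexp_neq0.
have hg0 : holomorphic_at g0 p.
  have hs : holomorphic_at (fun s => \sum_(m < M) (binpoly m).[s] * G m s) p.
    by apply: holo_sum => m _; exact: (holoM (holo_horner (binpoly m) p) (hG m)).
  exact: (holoD hD0 (holoM hk1 (holoD hs (tame_holomorphic r0 tH)))).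
(* Valid even where E s = 0 or s = p, since inverses of 0 are 0 on both
   sides. *)
have key s : disc p r s -> lerch_continuation s = g0 s + q.[s] * k s / (s - p).
  move=> Ds; have [eH _] := hH s Ds.
  rewrite /lerch_continuation eH -/(D0 s) -/(k1 s) /g0 -addrA; congr (_ + _).
  have bt m (t : {ffun 'I_m -> I}) : bad m t ->
      1 - geo_ratio s * word_prod beta t = L%:C * E s * (s - p).
    move=> /eqP h.
    have -> : geo_ratio s * word_prod beta t = cexp (- L%:C * s + L%:C * p).
      rewrite -[RHS]mul1r -h /geo_ratio cexpD.
      have -> : cexp (- L%:C * p) = (cexp (L%:C * p))^-1 by rewrite mulNr cexpN.
      by field; exact: cexp_neq0.
    by have := expm1_quotient_mul (- L%:C * s + L%:C * p); rewrite -/(E s) => e; rewrite -opprB -e; ring.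
  have term_split m : binomial_term m s = (binpoly m).[s] * G m s +
      (binpoly m).[s] * qc m * (L%:C * E s)^-1 / (s - p).
    rewrite /binomial_term -binpolyE /word_sum (bigID (bad m)) /= addrC mulrDr; congr (_ + _).
    rewrite -!mulrA; congr (_ * _); rewrite /qc mulr_suml; apply: eq_bigr => t bt'.
    by rewrite bt // invfM.
  rewrite (eq_bigr _ (fun (m : 'I_M) _ => term_split m)) big_split /=.
  have -> : q.[s] * k s / (s - p) =
      k1 s * \sum_(m < M) (binpoly m).[s] * qc m * (L%:C * E s)^-1 / (s - p).
    rewrite /q horner_sum /k !mulr_suml mulr_sumr; apply: eq_bigr => m _.
    by rewrite hornerM hornerC; ring.
  by rewrite -mulrDr; congr (_ * _); rewrite addrAC.
have q0 : (forall m (t : {ffun 'I_m -> I}), geo_ratio p * word_prod beta t != 1) -> q = 0.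
  move=> h; rewrite /q big1 // => m _; rewrite /qc big_pred0 ?polyC0 ?mulr0 // => t.
  exact/negbTE/h.
have nd : \forall s \near (p : C)^', disc p r s /\ s != p.
  by apply/dnear_nrm; exists r.
have [qz|qz] := eqVneq q 0.
  left; exists g0; split => //.
    apply: filterS nd => s [Ds sp]; by rewrite key // qz horner0 !mul0r addr0.
  by move=> _; rewrite key ?qz ?horner0 ?mul0r ?addr0 // /disc /= subrr nrm0.
have [qp|qp] := eqVneq q.[p] 0.
  have /factor_theorem [q1 eq1] : root q p by apply/rootP.
  left; exists (fun s => g0 s + q1.[s] * k s); split.
  - exact: (holoD hg0 (holoM (holo_horner q1 p) hk)).
  - apply: filterS nd => s [Ds sp]; rewrite key // eq1 hornerM hornerXsubC.
    have sp0 : s - p != 0 by rewrite subr_eq0.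
    by rewrite mulrAC mulfK.
  - by move=> /q0 h; rewrite h eqxx in qz.
right; exists (fun s => (s - p) * g0 s + q.[s] * k s); split.
- have h1 : holomorphic_at (fun s => s - p) p by exact: (holoD (holo_id p) (holo_cst (- p) p)).
  exact: (holoD (holoM h1 hg0) (holoM (holo_horner q p) hk)).
- by rewrite subrr mul0r add0r mulf_neq0.
- apply: filterS nd => s [Ds sp]; rewrite key //.
  have sp0 : s - p != 0 by rewrite subr_eq0.
  by rewrite [RHS]mulrDl [X in _ = X + _]mulrAC mulfV // mul1r.
- apply: contrapT => h; move/eqP: qz; apply; apply: q0 => m t; apply/eqP => e.
  by apply: h; exists m, t.
Qed.

Let F := regularize lerch_continuation.
Let no_word p := forall m (t : {ffun 'I_m -> I}), geo_ratio p * word_prod beta t != 1.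

Lemma small_no_word p : nrm (geo_ratio p) < 1 -> no_word p.
Proof.
move=> h m t; apply/eqP => e; have := nrm1 R; rewrite -e nrmM => e1.
have := word_prod_beta_le1 t; have := nrm_ge0 (geo_ratio p).
have := nrm_ge0 (word_prod beta t); nra.
Qed.

Lemma continuation_holomorphic p : no_word p -> holomorphic_at F p /\ F p = lerch_continuation p.
Proof.
move=> nw; have [[g [hg e e0]]|[h [_ _ _ [m [t e]]]]] := local_structure p.
  have E := regularize_removable hg e; split; first exact: holo_near_eq E hg.
  by rewrite e0 //; exact: regularizeE (holo_cont hg) e.
by have := nw m t; rewrite e eqxx.
Qed.

Lemma continuation_meromorphic : meromorphic F.
Proof.
move=> p; have [[g [hg e _]]|[h [hh hp e _]]] := local_structure p.
  left; exact: holo_near_eq (regularize_removable hg e) hg.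
by right; exists 1%N; exact: regularize_pole hh hp e.
Qed.

Lemma continuation_poles m p : is_pole m F p ->
  m = 1%N /\ exists k (t : {ffun 'I_k -> I}), geo_ratio p * word_prod beta t = 1.
Proof.
move=> hm; have [[g [hg e _]]|[h [hh hp e w]]] := local_structure p.
  have E := regularize_removable hg e.
  have E' : \forall s \near (p : C)^', F s = g s.
    by move/near_nrm: E => [u u0 E]; apply/dnear_nrm; exists u => // s _; exact: E.
  by have := pole_removable hg E' hm.
by split => //; exact: pole_order1 hh (regularize_quotient hh e) hm.
Qed.

End Main.

(** * Location of the poles *)

Section Poles.
Variables (R : realType) (r : nat) (alpha : nat -> R[i]) (A : R).
Hypothesis alpha1 : alpha 1%N = A%:C.
Hypothesis A1 : 1 < A.

(** The ratios 1 / A, alpha_2 / A, ..., alpha_r / A as one family on 'I_r. *)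
Definition word_ratio (i : 'I_r) : R[i] := (if i == 0%N :> nat then 1 else alpha i.+1) / A%:C.

(** The exponents k_i of the pole attached to t; k_(i-1) - k_i is then the number
    of occurrences of the letter i - 1, that is, of the root alpha_i. *)
Definition word_index m (t : {ffun 'I_m -> 'I_r}) (i : nat) : nat := \sum_(l < m) (i <= t l)%N.

Lemma word_admissible m (t : {ffun 'I_m -> 'I_r}) : admissible r (word_index t).
Proof.
split=> [i _|]; last by apply: big1 => l _; rewrite leqNgt ltn_ord.
apply: leq_sum => l _; case: (leqP i.+1 (t l)) => // h.
by rewrite (ltnW h).
Qed.

Lemma word_index_le m (t : {ffun 'I_m -> 'I_r}) i : (word_index t i <= m)%N.
Proof.
rewrite -[X in (_ <= X)%N]card_ord -sum1_card; apply: leq_sum => l _.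
exact: leq_b1.
Qed.

Lemma word_prod_tail m (t : {ffun 'I_m -> 'I_r}) :
  word_prod word_ratio t = (A%:C)^-1 ^+ m * tail_prod r alpha (word_index t).
Proof.
rewrite /word_prod /word_ratio big_split /= mulrC prodr_const card_ord; congr (_ * _).
have e i : (2 <= i)%N -> alpha i ^+ (word_index t i.-1 - word_index t i) =
    \prod_(l < m) alpha i ^+ (t l == i.-1 :> nat).
  move=> i2; rewrite prodrXr; congr (_ ^+ _).
  apply/eqP; rewrite -(eqn_add2r (word_index t i)) subnK.
    rewrite -big_split /=; apply/eqP; apply: eq_bigr => l _.
    case: i i2 => // i _ /=; rewrite eq_sym; case: ltngtP => h //; lia.
  case: i i2 => // i _ /=.
  apply: leq_sum => l _; case: (leqP i.+1 (t l)) => // h.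
  by rewrite (ltnW h).
rewrite /tail_prod big_nat_cond (eq_bigr (fun i => \prod_(l < m) alpha i ^+ (t l == i.-1 :> nat))); last first.
  by move=> i; rewrite andbT => /andP[i2 _]; exact: e.
rewrite -big_nat_cond exchange_big /=; apply: eq_bigr => l _.
case: eqP => [t0|t0].
  rewrite big_nat_cond big1 // => i; rewrite andbT => /andP[i2 _].
  by rewrite t0; case: i i2 => [|[|i]].
have h2 : (t l).+1 \in index_iota 2 r.+1.
  by rewrite mem_index_iota !ltnS ltn_ord lt0n; move/eqP: t0 => ->.
rewrite (bigD1_seq _ h2) ?iota_uniq //= eqxx expr1 big_nat_cond big1 ?mulr1 // => i.
move=> /andP[/andP[i2 _] ne]; case: eqP => // e'.
by move/eqP: ne; case; rewrite e' prednK // (leq_trans _ i2).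
Qed.

(** The logarithms of the factors of W(p) beta_t = 1 add up to a multiple of
    2 pi i.  Letters 0 are counted by j, the others by k_1. *)
Lemma pole_location (z p : R[i]) m (t : {ffun 'I_m -> 'I_r}) : z != 0 ->
  geo_ratio z A p * word_prod word_ratio t = 1 ->
  exists (j : nat) (n : int) (k : nat -> nat),
    admissible r k /\ p = - j%:R + sz_point r alpha z n k.
Proof.
move=> z0; rewrite word_prod_tail; set T := tail_prod _ _ _ => e.
have T0 : T != 0.
  by apply: contraTneq (oner_neq0 R[i]) => T0; rewrite -e T0 !mulr0 eqxx.
have A0 : 0 < A by apply: lt_trans A1.
have L0 : 0 < ln A by exact: ln_gt0.
pose k1 := word_index t 1.
have eA : (A%:C)^-1 ^+ m = cexp (- (m%:R * ln A)%:C).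
  rewrite -rmorphN cexp_real expRN expRM_natl lnK ?posrE //.
  by rewrite fmorphV rmorphXn exprVn.
move: e; rewrite /geo_ratio {1}(polar z0) {1}(polar T0) eA -!cexpD => /cexp_eq1 [n hn].
exists (m - k1)%N, (- n), (word_index t); split; first exact: word_admissible.
have hr := congr1 (@complex.Re R) hn; have hi := congr1 (@complex.Im R) hn.
rewrite !(cReD, cReM, cReN) !(cReD, cImD, cReM, cImM, cReN, cImN) /= in hr.
rewrite !(cImD, cImM, cImN) /= in hi.
have ma : ((m - k1)%:R : R) = m%:R - k1%:R by rewrite natrB // word_index_le.
have jc : ((m - k1)%:R : R[i]) = ((m - k1)%:R)%:C by rewrite rmorph_nat.
have nT : nrm (alpha 1%N ^- k1 * T) = (A ^+ k1)^-1 * nrm T.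
  by rewrite alpha1 nrmM nrmV nrmX nrm_real gtr0_norm.
have lnT : ln (nrm (alpha 1%N ^- k1 * T)) = - (k1%:R * ln A) + ln (nrm T).
  rewrite nT lnM ?posrE ?invr_gt0 ?exprn_gt0 ?nrm_gt0 // lnV ?posrE ?exprn_gt0 //.
  by rewrite lnXn // mulr_natl.
have pi0 : pi != 0 :> R by rewrite gt_eqF // pi_gt0.
have Ln0 : ln A != 0 by rewrite gt_eqF.
rewrite /sz_point /s_point -/T lnT alpha1 jc ma.
apply: complex_ext; rewrite !(cReD, cImD, cReN, cImN) /=.
  have -> : complex.Re p = (ln (nrm z) - m%:R * ln A + ln (nrm T)) / ln A.
    by apply: (mulIf Ln0); rewrite divfK //; lra.
  by field.
have -> : complex.Im p = (carg z + carg T - 2 * pi * n%:~R) / ln A.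
  by apply: (mulIf Ln0); rewrite divfK //; lra.
rewrite /xi mulrNz; move: (@pi R) pi0 => q q0; field; by rewrite Ln0 q0.
Qed.

End Poles.

Theorem theorem5p1 (R : realType) (a : nat -> int) (P : {poly int}) (r : nat)
    (alpha : nat -> R[i])
    (P_min : is_minimal_polynomial P a)
    (P_irr : irreducible_poly (map_poly intr P : {poly rat}))
    (P_deg : size P = r.+1)
    (P_roots : map_poly intr P = \prod_(1 <= i < r.+1) ('X - (alpha i)%:P))
    (alpha1_real : alpha 1%N \is Num.real)
    (alpha1_gt1 : 1 < alpha 1%N)
    (alpha1_dom : forall i : nat, (2 <= i <= r)%N -> `|alpha i| < alpha 1%N)
    (a_pos : forall n : nat, (1 <= n)%N -> 0 < a n)
    (a_incr : forall n : nat, (1 <= n)%N -> a n < a n.+1)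
    (z : R[i]) (z_neq0 : z != 0)
    (x : R) (x_ge0 : 0 <= x) (x_lt1 : x < 1) :
  let halfplane (s : R[i]) : Prop :=
    ln (ComplexField.Normc.normc z) / ln (complex.Re (alpha 1%N)) < complex.Re s in
  (forall s : R[i], halfplane s ->
     cvg (lerch_partial_sum a z x s @ \oo) /\
     holomorphic_at (lerch_phi a z x) s) /\
  exists F : R[i] -> R[i],
    [/\ meromorphic F,
        forall s : R[i], halfplane s -> F s = lerch_phi a z x s &
        forall (m : nat) (p : R[i]), is_pole m F p ->
          m = 1%N /\
          exists (j : nat) (n : int) (k : nat -> nat),
            admissible r k /\ p = - j%:R + sz_point r alpha z n k].
Proof.
move=> halfplane.
have r0 : (0 < r)%N := degree_gt0 P_min P_irr P_deg.
pose A := complex.Re (alpha 1%N).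
have eA : alpha 1%N = A%:C by rewrite RRe_real.
have A1 : 1 < A by rewrite -ltcR -eA.
have A0 : 0 < A by apply: lt_trans A1.
have Ac0 : A%:C != 0 :> R[i] by rewrite -nrm_eq0 nrm_real normr_eq0 gt_eqF.
have hal i : (2 <= i <= r)%N -> nrm (alpha i) < A.
  by move=> /alpha1_dom; rewrite eA nrmE ltcR.
have a1 : 0 < a 1%N by exact: a_pos.
pose c := binet_coef a r alpha.
have c10 : c 1%N != 0.
  by apply: (binet_coef1_neq0 P_min P_irr P_deg P_roots a1); rewrite eA.
pose beta := @word_ratio R r alpha A.
have beta1 i : nrm (beta i) < 1.
  rewrite /beta /word_ratio nrmM nrmV nrm_real gtr0_norm // ltr_pdivrMr // mul1r.
  by case: eqP => [_|i0]; [rewrite nrm1|apply: hal; rewrite ltn_ord andbT ltnS lt0n; apply/eqP].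
(* Letter 0 is reserved for x; letter i > 0 stands for the root alpha i.+1. *)
pose D i : R[i] := if i == 0%N then 0 else c i.+1.
have D0 : D 0%N = 0 by [].
have expand n : (2 <= n)%N ->
    (a n)%:~R = (A ^+ n)%:C * (c 1%N + \sum_(i < r) D i * beta i ^+ n).
  move=> n2; rewrite (binet P_min P_irr P_deg P_roots) // big_ltn ?ltnS // -/c.
  rewrite mulrDr; congr (_ + _); first by rewrite mulrC eA rmorphXn.
  pose bt (i : nat) : R[i] := (if i == 0%N then 1 else alpha i.+1) / A%:C.
  rewrite -(big_mkord xpredT (fun i => D i * bt i ^+ n)) [X in _ = _ * X]big_ltn //.
  rewrite D0 mul0r add0r.
  rewrite big_add1 /= mulr_sumr big_nat_cond [RHS]big_nat_cond.
  apply: eq_bigr => i; rewrite andbT => /andP[i0 _].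
  rewrite /D /bt gtn_eqF // rmorphXn [RHS]mulrCA -exprMn.
  by rewrite [X in _ = _ * X ^+ _]mulrC divfK.
have [th th01 hth] := ratio_bound beta1.
have th0 : 0 <= th by case/andP: th01.
have appr (e : R) : 0 < e -> exists n, (2 <= n)%N /\
    nrm (((a n)%:~R / A ^+ n)%:C - c 1%N) < e.
  move=> e0; have [M hM] := geom_small (\sum_(i < r) nrm (D i)) th01 e0.
  exists (maxn 2 M); split; first exact: leq_maxl.
  set n := maxn 2 M; apply: le_lt_trans (hM n (leq_maxr _ _)).
  have An0 : (A ^+ n)%:C != 0 :> R[i] by rewrite rmorphXn expf_neq0.
  have -> : ((a n)%:~R / A ^+ n)%:C - c 1%N = \sum_(i < r) D i * beta i ^+ n.
    rewrite rmorphM fmorphV /= rmorph_int expand ?leq_maxl // mulrC mulKf //.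
    by rewrite addrAC subrr add0r.
  rewrite mulr_suml; apply: le_trans (nrm_sum _ _ _) _; apply: ler_sum => i _.
  by rewrite nrmM nrmX ler_wpM2l ?nrm_ge0 // lerXn2r ?nnegrE ?nrm_ge0.
have an0 n : (2 <= n)%N -> 0 <= (a n)%:~R / A ^+ n :> R.
  by move=> n2; rewrite divr_ge0 ?exprn_ge0 ?(ltW A0) // ler0z ltW // a_pos // ltnW.
have Im0 : complex.Im (c 1%N) = 0.
  apply/eqP; rewrite -normr_eq0; apply: contraT => h.
  have h0 : 0 < `|complex.Im (c 1%N)| by rewrite lt_neqAle eq_sym h normr_ge0.
  have [n [n2 hn]] := appr _ h0.
  have := Im_le_nrm (((a n)%:~R / A ^+ n)%:C - c 1%N); rewrite cImD cImN /= sub0r normrN => h1.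
  by have := le_lt_trans h1 hn; rewrite ltxx.
have Re0 : 0 <= complex.Re (c 1%N).
  rewrite leNgt; apply/negP => h.
  have h0 : 0 < - complex.Re (c 1%N) by rewrite oppr_gt0.
  have [n [n2 hn]] := appr _ h0.
  have := Re_le_nrm (((a n)%:~R / A ^+ n)%:C - c 1%N); rewrite cReD cReN /= => h1.
  have := le_lt_trans h1 hn; have := an0 n n2 => h2.
  rewrite ger0_norm; lra.
set C1 := complex.Re (c 1%N) in Re0.
have ec : c 1%N = C1%:C by apply: complex_ext.
have C10 : 0 < C1.
  rewrite lt_neqAle Re0 andbT; apply: contra c10 => /eqP h.
  by rewrite ec -h.
pose b n : R := (a n)%:~R + x.
pose d (i : 'I_r) : R[i] := (if i == 0%N :> nat then x%:C else c i.+1) / c 1%N.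
have b_exp2 n : (2 <= n)%N -> (b n)%:C = (C1 * A ^+ n)%:C * (1 + \sum_i d i * beta i ^+ n).
  move=> n2; rewrite /b rmorphD /= rmorph_int expand // rmorphM /= -ec.
  have An0 : (A ^+ n)%:C != 0 :> R[i] by rewrite rmorphXn expf_neq0.
  have -> : \sum_i d i * beta i ^+ n =
      (c 1%N)^-1 * (\sum_(i < r) D i * beta i ^+ n + x%:C / (A ^+ n)%:C).
    rewrite (bigD1 (Ordinal r0)) //= [X in _ * (X + _)](bigD1 (Ordinal r0)) //=.
    rewrite D0 mul0r add0r mulrDr mulr_sumr addrC /d /D /beta /word_ratio /=.
    congr (_ + _); last by rewrite mul1r rmorphXn exprVn; ring.
    apply: eq_bigr => i i0.
    have -> : (i == 0%N :> nat) = false by apply/negbTE.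
    by ring.
  by field; rewrite c10 An0.
have [M hM] := geom_small (\sum_i nrm (d i)) th01 ltr01.
(* At least 2, because Binet's formula is available only from n = 2 on. *)
pose N := maxn 2 M.
have N0 : (0 < N)%N by rewrite leq_max.
have y1 : \sum_i nrm (d i) * nrm (beta i) ^+ N < 1.
  apply: le_lt_trans (hM N (leq_maxr _ _)); rewrite mulr_suml; apply: ler_sum => i _.
  by rewrite ler_wpM2l ?nrm_ge0 // lerXn2r ?nnegrE ?nrm_ge0.
have b_exp n : (N <= n)%N -> (b n)%:C = (C1 * A ^+ n)%:C * (1 + \sum_i d i * beta i ^+ n).
  by move=> Nn; apply: b_exp2; apply: leq_trans (leq_maxl _ _) Nn.
have L0 : 0 < ln A by exact: ln_gt0.
have small s : halfplane s -> nrm (geo_ratio z A s) < 1.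
  rewrite /halfplane -/A ltr_pdivrMr // => hs.
  rewrite /geo_ratio nrmM nrm_cexp -{1}[nrm z]lnK ?posrE ?nrm_gt0 // -expRD -expR0 ltr_expR.
  by rewrite mulNr cReN cReM /= mul0r subr0; lra.
pose F := regularize (lerch_continuation d beta b z A C1 N).
have hF s : halfplane s -> [/\ holomorphic_at F s, F s = lerch_phi a z x s &
    (lerch_partial_sum a z x s) @ \oo --> (F s : R[i]^o)].
  move=> /small hs.
  have [h1 h2] := continuation_holomorphic b C1 z_neq0 A1 beta1 y1 (small_no_word beta1 hs).
  have h3 := dirichlet_cvg A1 C10 beta1 y1 N0 b_exp hs.
  have hFs : F s = lerch_continuation d beta b z A C1 N s := h2.
  have e : lerch_phi a z x s = lerch_continuation d beta b z A C1 N s by exact: (@cvg_lim R[i]^o _ _ _ _ _ _ h3).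
  split; [exact: h1|by rewrite hFs e|by rewrite hFs; exact: h3].
split.
  move=> s hs; have [h1 h2 h3] := hF s hs; split; first by apply/cvg_ex; exists (F s).
  apply: holo_near_eq h1.
  have e0 : 0 < complex.Re s - ln (nrm z) / ln A by rewrite subr_gt0.
  apply/near_nrm; exists (complex.Re s - ln (nrm z) / ln A) => // t ht.
  have ht' : halfplane t.
    have := Re_le_nrm (t - s); rewrite cReD cReN ler_norml /halfplane -/A => /andP[h _].
    lra.
  by have [_ -> _] := hF t ht'.
exists F; split.
- by have := continuation_meromorphic b C1 z_neq0 A1 beta1 y1.
- by move=> s hs; have [] := hF s hs.
- move=> m p hm.
  have [-> [k [t e]]] := continuation_poles z_neq0 A1 beta1 y1 hm.
  by split => //; exact: (pole_location eA A1 z_neq0 e).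
Qed.
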